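(* Let $G$ be a graph on $n$ vertices. Suppose that the binomial edge ideal $J_G$ is an unmixed ideal of König type. Then $G$ is weakly closed.
   Context: Graphs are finite and simple. For a graph $G$ on vertex set $[n]=\{1,\dots,n\}$ and a field $\Bbbk$, let $R=\Bbbk[x_1,\dots,x_n,y_1,\dots,y_n]$ (standard graded) and $f_{i,j}=x_iy_j-x_jy_i$. The binomial edge ideal of $G$ is $J_G=(f_{i,j}\mid \{i,j\}\in E(G))\subseteq R$. An ideal is unmixed if all of its associated primes have the same height. A graded ideal $I$ of height $h$ in a polynomial ring over a field is of König type if there exist a sequence $g_1,\dots,g_h$ of homogeneous polynomials that form part of a minimal system of generators of $I$ and a monomial order $<$ such that $\mathrm{in}_<(g_1),\dots,\mathrm{in}_<(g_h)$ is a regular sequence. (For binomial edge ideals, unmixedness and being of König type do not depend on the base field.) A graph $G$ on $n$ vertices is weakly closed if there is a labeling of its vertices by $1,\dots,n$ such that for every edge $\{i,j\}$ with $i<j$ and every integer $k$ with $i<k<j$, either $\{i,k\}\in E(G)$ or $\{k,j\}\in E(G)$. *)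

(* Defs.v *)
From mathcomp Require Import all_boot all_order all_fingroup all_algebra.
From mathcomp Require Import mpoly.

Set Implicit Arguments.
Unset Strict Implicit.
Unset Printing Implicit Defensive.

Import GRing.Theory.
Local Open Scope ring_scope.

(* Ideals are predicates in Prop, compared extensionally: ideal membership    *)
(* is not assumed to be decidable.                                            *)
Section CommutativeAlgebra.

Variable S : comNzRingType.
Implicit Types (I P Q : S -> Prop) (s : seq S).

Definition subideal I Q : Prop := forall x, I x -> Q x.

Definition eqideal I Q : Prop := forall x, I x <-> Q x.

Definition is_ideal I : Prop :=
  [/\ I 0,
      forall x y, I x -> I y -> I (x + y)
    & forall a x, I x -> I (a * x)].

Definition is_prime_ideal P : Prop :=
  [/\ is_ideal P, ~ P 1 & forall x y, P (x * y) -> P x \/ P y].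

Definition ideal_gen (A : S -> Prop) (x : S) : Prop :=
  exists2 cs : seq (S * S),
    forall c, c \in cs -> A c.2 & x = \sum_(c <- cs) c.1 * c.2.

Definition ideal_of_seq s : S -> Prop := ideal_gen (fun x => x \in s).

(* The associated primes of S / I. *)
Definition associated_prime I P : Prop :=
  is_prime_ideal P /\ exists a, forall b, P b <-> I (b * a).

(* There is a chain of primes Q 0 < Q 1 < ... < Q h = P. *)
Definition prime_height_ge P (h : nat) : Prop :=
  exists Q : nat -> S -> Prop,
    [/\ forall i, (i <= h)%N -> is_prime_ideal (Q i),
        forall i, (i < h)%N ->
          subideal (Q i) (Q i.+1) /\ ~ subideal (Q i.+1) (Q i)
      & eqideal (Q h) P].

Definition prime_height P (h : nat) : Prop :=
  prime_height_ge P h /\ ~ prime_height_ge P h.+1.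

(* The least height of a prime containing I. *)
Definition ideal_height I (h : nat) : Prop :=
  (exists P, [/\ is_prime_ideal P, subideal I P & prime_height P h]) /\
  (forall P, is_prime_ideal P -> subideal I P -> prime_height_ge P h).

Definition unmixed I : Prop :=
  forall P Q, associated_prime I P -> associated_prime I Q ->
    forall h, prime_height P h <-> prime_height Q h.

Definition regular_sequence s : Prop :=
  (forall i, (i < size s)%N ->
     forall a, ideal_of_seq (take i s) (a * s`_i) -> ideal_of_seq (take i s) a)
  /\ ~ ideal_of_seq s 1.

End CommutativeAlgebra.

Section PolynomialIdeals.

Variables (k : fieldType) (m : nat).
Implicit Types (I : {mpoly k[m]} -> Prop) (s gs : seq {mpoly k[m]}).

Definition homogeneous (p : {mpoly k[m]}) : Prop := exists d, p \is d.-homog.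

(* Minimality is among homogeneous systems of generators: without             *)
(* homogeneity, x^2 would be part of the irredundant system x^2, x + x^2      *)
(* of generators of (x).                                                      *)
Definition minimal_generators I s : Prop :=
  [/\ forall p, p \in s -> homogeneous p,
      eqideal (ideal_of_seq s) I
    & forall s', subseq s' s -> eqideal (ideal_of_seq s') I -> s' = s].

Definition monomial_order (le : rel 'X_{1..m}) : Prop :=
  [/\ antisymmetric le, transitive le, total le,
      forall u, le 0%MM u
    & forall u v w, le u v -> le (u + w)%MM (v + w)%MM].

Definition initial_exponent (le : rel 'X_{1..m}) (p : {mpoly k[m]}) :
    'X_{1..m} :=
  foldr (fun u v => if le u v then v else u) 0%MM (msupp p).

Definition initial_term (le : rel 'X_{1..m}) (p : {mpoly k[m]}) :
    {mpoly k[m]} :=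
  p@_(initial_exponent le p) *: 'X_[initial_exponent le p].

(* That I is graded follows from the existence of homogeneous generators. *)
Definition konig_type I : Prop :=
  exists gs : seq {mpoly k[m]}, exists le : rel 'X_{1..m},
    [/\ ideal_height I (size gs),
        exists s, minimal_generators I (gs ++ s),
        monomial_order le
      & regular_sequence [seq initial_term le g | g <- gs]].

End PolynomialIdeals.

Section BinomialEdgeIdeal.

Variables (n : nat) (k : fieldType).

(* The first n of the n + n variables are the x_i, the last n the y_i. *)
Definition xvar (i : 'I_n) : {mpoly k[n + n]} := 'X_(lshift n i).

Definition yvar (i : 'I_n) : {mpoly k[n + n]} := 'X_(rshift n i).

Definition edge_binomial (i j : 'I_n) : {mpoly k[n + n]} :=
  xvar i * yvar j - xvar j * yvar i.

Definition binomial_edge_ideal (e : rel 'I_n) : {mpoly k[n + n]} -> Prop :=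
  ideal_gen (fun p => exists i j, e i j /\ p = edge_binomial i j).

End BinomialEdgeIdeal.

Arguments binomial_edge_ideal {n} k e _.

(* l i is the label of the vertex i. *)
Definition weakly_closed (n : nat) (e : rel 'I_n) : Prop :=
  exists l : {perm 'I_n}, forall i j v : 'I_n,
    e i j -> (l i < l v)%N -> (l v < l j)%N -> e i v \/ e v j.

(* Main.v *)
Require Import Defs.
From HB Require Import structures.
From mathcomp Require Import all_boot all_order all_fingroup all_algebra.
From mathcomp Require Import mpoly.
From mathcomp Require Import zify ring.
From Stdlib Require Import Classical.

(** Write [J] for the binomial edge ideal of the graph [G] on [n] vertices and
  [c(S)] for the number of components of [G - S].

  Heights.  A set [S] of vertices defines a prime [graph_prime S] above [J]:
  the kernel of the parametrization [x_v = u_v], [y_v = u_v t_c] for [v] in the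
  component [c] of [G - S], and [x_v = y_v = 0] for [v] in [S].  This
  parametrization arises from an injective one by substituting away
  [|S| + n - c(S)] variables one after the other, which gives a chain of primes
  of that length below [graph_prime S]; counting linearly independent families
  of bounded degree shows that no chain is longer ([graph_prime_height]).

  Unmixedness.  Call [S] a cut set if each [s] in [S] has neighbours in two
  components of [G - S].  Then [graph_prime S] is an associated prime of [J]
  ([cut_set_associated]), because already the localization of [J] at it is
  generated by the elements [x_s], [y_s] for [s] in [S] and the binomials
  inside the components.  The empty set is a cut set, so unmixedness makes
  [c(S) - |S|] equal to [c(G)] for every cut set.  Moreover every prime above
  [J] contains [graph_prime S] for some cut set [S] ([prime_above_J]), so [J]
  has height [n - c(G)].

  Koenig type.  Minimal generators of [J] are quadrics, with initial monomials
  [x_a y_b] for edges [ab].  Read [x_a y_b] as an arrow from [a] to [b].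
  Monomials in a regular sequence are coprime, so arrows form disjoint paths and
  cycles; the monomial order forbids cycles ([konig_matching]).  Hence there are
  [n - c(G)] arrows and as many paths as components of [G].

  Conclusion.  Label the vertices path by path.  Suppose that [i < v < j] for an
  edge [ij] while [v] is adjacent to neither end.  The neighbours of [v] that are
  adjacent to the component of [i] in [G - N(v)] form a cut set [S] that separates
  [v] from [i] and [j] ([neighbourhood_cut_set]).  Deleting [S] leaves at most
  [|S| + c(G) = c(S)] pieces of paths, so every component of [G - S] is a single
  piece; but the piece containing [i] and [j] passes through [v]
  ([between_connect]), a contradiction. *)

Set Implicit Arguments.
Unset Strict Implicit.
Unset Printing Implicit Defensive.

Import GRing.Theory.

(** * Vertex deletion and cut sets *)

Section Deletion.

Variables (V : finType) (e : rel V).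
Hypothesis e_sym : ssrbool.symmetric e.
Implicit Types (S : {set V}) (i u v : V).

Definition deletion S : rel V := fun u v => [&& e u v, u \notin S & v \notin S].

Definition component S v : V := fingraph.root (deletion S) v.

Lemma deletion_csym S : connect_sym (deletion S).
Proof.
apply: sym_connect_sym => u v; rewrite /deletion e_sym.
by rewrite [(u \notin S) && _]andbC.
Qed.

Lemma connect_ind (r : rel V) (P : V -> Prop) u :
  P u -> (forall v w, connect r u v -> P v -> r v w -> P w) ->
  forall v, connect r u v -> P v.
Proof.
move=> Pu step v /connectP[p rp ->] {v}.
elim/last_ind: p rp => [//|p w IHp]; rewrite rcons_path last_rcons => /andP[rp rw].
by apply: step rw; [apply/connectP; exists p | apply: IHp].
Qed.

Lemma connect_notin S u v :
  connect (deletion S) u v -> u \notin S -> v \notin S.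
Proof.
move=> cuv uS; move: v cuv; apply: connect_ind => // v w _ _.
by case/and3P.
Qed.

Lemma eq_component S u v :
  (component S u == component S v) = connect (deletion S) u v.
Proof. by rewrite /component root_connect //; apply: deletion_csym. Qed.

Lemma componentK S v : component S (component S v) = component S v.
Proof. exact/eqP/roots_root/deletion_csym. Qed.

Lemma component_notin S v : v \notin S -> component S v \notin S.
Proof. exact/connect_notin/connect_root. Qed.

Definition cut_set S :=
  [forall s in S, exists a, exists b,
     [&& e s a, e s b, a \notin S, b \notin S & ~~ connect (deletion S) a b]].

Lemma cut_set0 : cut_set set0.
Proof. by apply/forall_inP => s; rewrite inE. Qed.

(** Take for [S] those vertices of [N(v)] that have a neighbour in the component
  [C] of [i] in [G - N(v)].  Each of them sees both [v] and [C], and [C] remains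
  a component of [G - S], so [S] is a cut set that isolates [i] from [v]. *)
Lemma neighbourhood_cut_set i v : irreflexive e -> i != v -> ~~ e v i ->
  exists S, [/\ cut_set S, v \notin S, forall w, ~~ e v w -> w \notin S
              & ~~ connect (deletion S) i v].
Proof.
move=> e_irr niv nvi; pose Nv := [set s | e v s].
pose inC w := connect (deletion Nv) i w.
pose S := [set s | e v s & [exists w, e s w && inC w]].
have NS w : ~~ e v w -> w \notin S by rewrite inE => /negPf ->.
have vS : v \notin S by apply: NS; rewrite e_irr.
have CN w : inC w -> ~~ e v w.
  by move/connect_notin; rewrite !inE; apply.
have nCv : ~~ inC v.
  rewrite /inC deletion_csym //; apply/negP => c.
  suff Ei : i = v by move: niv; rewrite Ei eqxx.
  move: i c {niv nvi inC S NS CN vS}; apply: connect_ind => // u w _ -> /and3P[evw _].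
  by rewrite inE evw.
have closed w w' : inC w -> connect (deletion S) w w' -> inC w'.
  move=> Cw; move: w'; apply: connect_ind => // u u' _ Cu /and3P[euu' _ u'S].
  have nu' : ~~ e v u'.
    apply: contra u'S => evu'; rewrite inE evu'; apply/existsP; exists u.
    by rewrite e_sym euu'.
  have nu := CN _ Cu; apply: connect_trans Cu (connect1 _).
  by rewrite /deletion euu' !inE nu' nu.
exists S; split=> //; last first.
  by apply: contra nCv; apply: closed; apply: connect0.
apply/forall_inP => s; rewrite inE => /andP[evs /existsP[w /andP[esw Cw]]].
apply/existsP; exists v; apply/existsP; exists w.
rewrite e_sym evs esw vS NS ?CN //=; rewrite deletion_csym //.
by apply: contra nCv; apply: closed.
Qed.

End Deletion.

(** * Path covers and labelings *)

Section PathCover.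

Variables (V : finType) (M : seq (V * V)).
Hypotheses (uM1 : uniq (unzip1 M)) (uM2 : uniq (unzip2 M))
  (acyclic : forall W : {set V}, W != set0 ->
     exists2 b, b \in W & forall a, a \in W -> (a, b) \notin M).
Implicit Types (u v w : V) (d : nat).

Definition has_pred v := v \in unzip2 M.
Definition predecessor v := if [pick u | (u, v) \in M] is Some u then u else v.
Local Notation pr := predecessor.

Lemma predecessorP v : has_pred v -> (pr v, v) \in M.
Proof.
move=> /mapP[[u w] Muw /= Ew]; rewrite /pr; case: pickP => [//|/(_ u)].
by rewrite Ew Muw.
Qed.

Lemma predecessor_inj u v : has_pred u -> has_pred v -> pr u = pr v -> u = v.
Proof.
move=> /predecessorP + /predecessorP + Epr; rewrite Epr.
move=> /(nthP (u, u))[i lti Ei] /(nthP (u, u))[j ltj Ej].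
suff Eij : i = j by move: Ei; rewrite Eij Ej => -[].
apply/eqP; rewrite -(nth_uniq u _ _ uM1) ?size_map //.
by rewrite !(nth_map (u, u)) // Ei Ej.
Qed.

(** A set of vertices that never reach a source would be closed under
  predecessors, against acyclicity. *)
Lemma has_source v : exists d, ~~ has_pred (iter d pr v).
Proof.
pose W := [set v | [forall u, fconnect pr v u ==> has_pred u]].
suff W0 : W = set0.
  have := in_set0 v; rewrite -W0 inE => /negbT; rewrite negb_forall.
  case/existsP => u; rewrite negb_imply => /andP[cvu nu].
  by exists (findex pr v u); rewrite iter_findex.
apply/eqP/negPn/negP => /acyclic[b]; rewrite inE => /forallP Wb noa.
have hb : has_pred b by have := Wb b; rewrite connect0.
suff Wpr : pr b \in W by have := noa _ Wpr; rewrite predecessorP.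
rewrite inE; apply/forallP => u; apply/implyP => cu; have /implyP := Wb u; apply.
exact: connect_trans (fconnect1 _ _) cu.
Qed.

Definition depth v := ex_minn (has_source v).
Definition source v := iter (depth v) pr v.

Lemma source_nopred v : ~~ has_pred (source v).
Proof. by rewrite /source /depth; case: ex_minnP. Qed.

Lemma has_pred_iter v d : d < depth v -> has_pred (iter d pr v).
Proof.
rewrite /depth; case: ex_minnP => m _ minm ltd; apply/negPn/negP => /minm.
by rewrite leqNgt ltd.
Qed.

Lemma depth_pred v : has_pred v -> depth v = (depth (pr v)).+1.
Proof.
move=> hv; apply/eqP; rewrite eqn_leq; apply/andP; split.
  have := source_nopred (pr v); rewrite /source -iterSr.
  by rewrite {2}/depth; case: ex_minnP => m _ minm; apply: minm.
have := source_nopred v; rewrite {1}/depth; case: ex_minnP => m nm minm ns.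
case Ed: (depth v) => [|d]; first by move: ns; rewrite /source Ed /= hv.
by rewrite ltnS; apply: minm; rewrite -iterSr -Ed.
Qed.

Lemma depth_iter v d : d <= depth v -> depth (iter d pr v) = depth v - d.
Proof.
elim: d => [|d IHd] led; first by rewrite subn0.
have /= := depth_pred (has_pred_iter led); rewrite IHd 1?ltnW //.
by rewrite subnS => ->.
Qed.

Lemma source_iter v d : d <= depth v -> source (iter d pr v) = source v.
Proof. by move=> led; rewrite /source depth_iter // -iterD subnK. Qed.

Lemma iter_predecessor_inj d u v : d <= depth u -> d <= depth v ->
  iter d pr u = iter d pr v -> u = v.
Proof.
elim: d => [//|d IHd] ltu ltv /= Epr; apply: IHd; try exact: ltnW.
exact: predecessor_inj (has_pred_iter ltu) (has_pred_iter ltv) Epr.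
Qed.

Lemma ancestor u v : source u = source v -> depth u <= depth v ->
  u = iter (depth v - depth u) pr v.
Proof.
move=> Es led; have Ed : depth (iter (depth v - depth u) pr v) = depth u.
  by rewrite depth_iter ?leq_subr // subKn.
apply: (@iter_predecessor_inj (depth u)); rewrite ?Ed //.
by rewrite -iterD subnKC.
Qed.

(** The lexicographic order on pairs of a source and a depth, as a natural
  number: the paths come one after the other, each from its source onwards. *)
Definition path_key v :=
  enum_rank (source v) * (\max_u depth u).+1 + depth v.

Lemma depth_max v : depth v < (\max_u depth u).+1.
Proof. by rewrite ltnS; apply: leq_bigmax. Qed.

Lemma path_key_inj : injective path_key.
Proof.
move=> u v; rewrite /path_key; set K := (_).+1 => Ek.
have Eu := divnMDl (enum_rank (source u)) (depth u) (ltn0Sn (\max_u depth u)).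
have Ev := divnMDl (enum_rank (source v)) (depth v) (ltn0Sn (\max_u depth u)).
have Es : source u = source v.
  apply/enum_rank_inj/val_inj => /=; move: Eu Ev; rewrite -/K Ek => ->.
  by rewrite !(divn_small (depth_max _)) !addn0.
have Ed : depth u = depth v by move: Ek; rewrite Es => /addnI.
by rewrite (ancestor Es) ?Ed // subnn.
Qed.

Lemma path_key_between u v w : source u = source w ->
  path_key u < path_key v -> path_key v < path_key w ->
  source v = source u /\ depth u < depth v < depth w.
Proof.
move=> Euw; rewrite /path_key -Euw; have := depth_max u; have := depth_max v.
have := depth_max w; set K := (\max_u depth u).+1 => ltw ltv ltu ltuv ltvw.
have Es : source v = source u.
  apply/enum_rank_inj/val_inj => /=.
  move: (nat_of_ord (enum_rank (source v))) (nat_of_ord (enum_rank (source u)))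
    ltuv ltvw => a b ltuv ltvw.
  clearbody K; have [ltab|ltba|//] := ltngtP a b; nia.
by split=> //; move: ltuv ltvw; rewrite Es !ltn_add2l => -> ->.
Qed.

Section Deleted.

Variables (e : rel V) (S : {set V}).
Hypotheses (e_sym : ssrbool.symmetric e) (Me : forall a b, (a, b) \in M -> e a b).
Local Notation comp := (component e S).

(** Going backwards along a path, one leaves a piece of the path minus [S] at
  such a vertex. *)
Definition stops v := ~~ has_pred v || (pr v \in S).

Lemma has_stop v : exists d, stops (iter d pr v).
Proof. by have [d nd] := has_source v; exists d; rewrite /stops nd. Qed.

Definition piece_depth v := ex_minn (has_stop v).
Definition piece_start v := iter (piece_depth v) pr v.

Lemma piece_start_stops v : stops (piece_start v).
Proof. by rewrite /piece_start /piece_depth; case: ex_minnP. Qed.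

Lemma piece_depth_le v : piece_depth v <= depth v.
Proof.
rewrite /piece_depth; case: ex_minnP => m _ minm; apply: minm.
by rewrite /stops source_nopred.
Qed.

Lemma piece_connect v d : v \notin S -> d <= piece_depth v ->
  iter d pr v \notin S /\ connect (deletion e S) v (iter d pr v).
Proof.
move=> vS; elim: d => [//|d IHd] ltd; have [dS cvd] := IHd (ltnW ltd).
have : ~~ stops (iter d pr v).
  move: ltd; rewrite /piece_depth; case: ex_minnP => m _ minm ltd.
  by apply/negP => /minm; rewrite leqNgt ltd.
rewrite negb_or negbK => /andP[hd prS]; split=> //=.
apply: connect_trans cvd (connect1 _).
by rewrite /deletion dS prS e_sym (Me (predecessorP hd)).
Qed.

(** Removing [S] cuts the [#|V| - size M] paths into at most
  [#|V| - size M + #|S|] pieces.  If there are at least that many components,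
  every component consists of a single piece. *)
Lemma piece_start_component :
  #|V| + #|S| <= size M + #|[set v | v \notin S & comp v == v]| ->
  forall u v, u \notin S -> v \notin S -> comp u = comp v ->
  piece_start u = piece_start v.
Proof.
set C := [set v | _ & _] => leC; pose T := [set v | v \notin S & stops v].
have cM : #|[set v | has_pred v]| = size M.
  rewrite cardsE -(size_map snd M) -/(unzip2 M) -(card_uniqP uM2).
  by apply: eq_card => v.
have cT : #|T| <= #|V| - size M + #|S|.
  have sT : T \subset ~: [set v | has_pred v] :|: [set v | has_pred v & pr v \in S].
    by apply/subsetP => v; rewrite !inE => /andP[_]; rewrite /stops; case: has_pred.
  apply: leq_trans (subset_leq_card sT) _; apply: leq_trans (leq_card_setU _ _) _.
  rewrite cardsCs setCK cM leq_add2l.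
  have /card_in_imset <- : {in [set v | has_pred v & pr v \in S] &, injective pr}.
    by move=> u v; rewrite !inE => /andP[hu _] /andP[hv _]; apply: predecessor_inj.
  apply: subset_leq_card; apply/subsetP => _ /imsetP[v + ->].
  by rewrite inE => /andP[].
have startT v : v \notin S -> piece_start v \in T /\ comp (piece_start v) = comp v.
  move=> vS; have [sS c] := piece_connect vS (leqnn _).
  split; first by rewrite inE sS piece_start_stops.
  by apply/eqP; rewrite eq_sym eq_component.
have sizeM : size M <= #|V| by rewrite -cM max_card.
have CT : C \subset comp @: T.
  apply/subsetP => c; rewrite inE => /andP[cS /eqP Ec].
  have [Tc Ecc] := startT c cS; apply/imsetP; exists (piece_start c) => //.
  by rewrite Ecc Ec.
have /imset_injP injT : #|comp @: T| == #|T|.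
  rewrite eqn_leq leq_imset_card /=; apply: leq_trans (subset_leq_card CT).
  by apply: leq_trans cT _; lia.
move=> u v uS vS Euv; have [Tu Eu] := startT u uS; have [Tv Ev] := startT v vS.
by apply: injT => //; rewrite Eu Ev.
Qed.

(** The count makes every component a single piece, so the pieces of [u] and [w]
  start at the same vertex, and [u] and [v] lie on the walk from [w] back to it,
  which avoids [S]. *)
Lemma between_connect u v w :
  #|V| + #|S| <= size M + #|[set v | v \notin S & comp v == v]| ->
  u \notin S -> w \notin S -> comp u = comp w ->
  path_key u < path_key v -> path_key v < path_key w ->
  connect (deletion e S) w v.
Proof.
move=> leC uS wS Euw ltuv ltvw.
have Est := piece_start_component leC uS wS Euw.
have Es : source u = source w.
  rewrite -(source_iter (piece_depth_le u)) -(source_iter (piece_depth_le w)).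
  by rewrite -/(piece_start u) Est.
have [Esv /andP[duv dvw]] := path_key_between Es ltuv ltvw.
rewrite (@ancestor v w) ?Esv //; last exact: ltnW.
have [] // := @piece_connect w (depth w - depth v) wS.
have := congr1 depth Est; rewrite /piece_start !depth_iter ?piece_depth_le //.
by have := piece_depth_le u; have := piece_depth_le w; lia.
Qed.

End Deleted.
End PathCover.

Lemma rank_perm n (key : 'I_n -> nat) : injective key ->
  exists l : {perm 'I_n}, forall i j, (l i < l j)%N -> (key i < key j)%N.
Proof.
move=> injk; pose below v := [set u | key u < key v].
have lt v : #|below v| < n.
  rewrite -[X in _ < X]card_ord -cardsT; apply: proper_card.
  by apply/properP; split; [exact: subsetT | exists v; rewrite inE // ltnn].
have mono u v : #|below u| < #|below v| -> key u < key v.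
  rewrite !ltnNge; apply: contra => lek; apply: subset_leq_card.
  by apply/subsetP => w; rewrite !inE => /leq_trans; apply.
have injr : injective (fun v => Ordinal (lt v)).
  move=> u v /(congr1 val) /= E; apply: injk; apply/eqP; rewrite eqn_leq.
  suff H a b : #|below a| = #|below b| -> key a <= key b by rewrite !H.
  move=> Eab; rewrite leqNgt; apply/negP => ltk.
  suff : #|below b| < #|below a| by rewrite Eab ltnn.
  apply: proper_card; apply/properP; split; last by exists b; rewrite !inE // ltnn.
  by apply/subsetP => w; rewrite !inE => /ltn_trans; apply.
by exists (perm injr) => i j; rewrite !permE; apply: mono.
Qed.

Local Open Scope ring_scope.

(** * Heights of primes *)

Section Heights.

Variable S : comNzRingType.
Implicit Types (P Q : S -> Prop) (h : nat).

Lemma prime_height_ge_le P h h' :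
  (h' <= h)%N -> prime_height_ge P h -> prime_height_ge P h'.
Proof.
move=> leh [Q [prQ ltQ eqQ]]; exists (fun i => Q (i + (h - h'))%N); split.
- by move=> i lei; apply: prQ; lia.
- by move=> i lti; rewrite addSn; apply: ltQ; lia.
- by rewrite subnKC.
Qed.

Lemma prime_height_ge_sub P P' h :
  is_prime_ideal P' -> subideal P P' ->
  prime_height_ge P h -> prime_height_ge P' h.
Proof.
move=> prP' sPP' [Q [prQ ltQ eqQ]].
exists (fun i => if (i < h)%N then Q i else P'); split.
- by move=> i lei; case: ltnP => // lti; apply: prQ; lia.
- move=> i lti; rewrite lti; case: ltnP => lti'; first exact: ltQ.
  have /ltQ [s12 ns21] := lti; have Eh : i.+1 = h by lia.
  by rewrite Eh in s12 ns21; split=> [x /s12 /eqQ /sPP' //|s]; apply: ns21 => x /eqQ /sPP' /s.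
- by rewrite ltnn => x.
Qed.

Lemma prime_height_uniq P h h' : prime_height P h -> prime_height P h' -> h = h'.
Proof.
suff H a b : prime_height P a -> prime_height P b -> (a <= b)%N.
  by move=> Ph Ph'; apply/eqP; rewrite eqn_leq !H.
move=> [ga _] [_ nb]; rewrite leqNgt; apply/negP => ltba.
exact/nb/prime_height_ge_le/ga.
Qed.

End Heights.

Section DimensionBound.

Variables (k : fieldType) (N : nat).
Local Notation R := {mpoly k[N]}.
Implicit Types (P Q : R -> Prop).

(** Linear independence over [k] in the quotient by [Q]. *)
Definition free_mod Q (I : finType) (b : I -> R) : Prop :=
  forall c : I -> k, Q (\sum_i c i *: b i) -> forall i, c i = 0.

Lemma is_idealB Q x y : is_ideal Q -> Q x -> Q y -> Q (x - y).
Proof. by case=> _ QD QM Qx Qy; apply: QD => //; rewrite -mulN1r; apply: QM. Qed.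

(** In a relation modulo [Q] between the products [f ^ j * b i], the coefficient
  of the lowest power of [f] lies in [P] once that power has been cancelled,
  since [f] lies in [P] but not in [Q]; so its coefficients vanish. *)
Lemma free_mod_powers P Q (I : finType) (b : I -> R) (f : R) d :
  is_prime_ideal P -> is_prime_ideal Q -> subideal Q P ->
  free_mod P b -> P f -> ~ Q f ->
  free_mod Q (fun ji : 'I_d * I => f ^+ ji.1 * b ji.2).
Proof.
move=> [idP _ _] [idQ _ prQ] sQP frP Pf nQf.
pose B (c : I -> k) := \sum_i c i *: b i.
have main e (c : nat -> I -> k) :
    Q (\sum_(j < e) f ^+ j * B (c j)) -> forall j, (j < e)%N -> c j =1 fun=> 0.
  elim: e c => [//|e IHe] c; rewrite big_ord_recl expr0 mul1r.
  rewrite (eq_bigr (fun j : 'I_e => f * (f ^+ j * B (c j.+1)))); last first.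
    by move=> j _; rewrite mulrA -exprS.
  rewrite -mulr_sumr; set r := \sum_j _ => Q0.
  have c0 : c 0%N =1 fun=> 0.
    apply: frP; rewrite -/(B (c 0%N)) -[B _](addrK (f * r)).
    apply: is_idealB => //; first exact: sQP.
    by rewrite mulrC; case: idP => _ _; apply.
  have B0 : B (c 0%N) = 0 by rewrite /B big1 // => i _; rewrite c0 scale0r.
  move: Q0; rewrite B0 add0r => /prQ [//|Qr].
  by case=> [//|j] ltj; apply: (IHe (fun j => c j.+1)).
move=> c Qc [j i]; pose c' j' i' : k := if insub j' is Some o then c (o, i') else 0.
suff /(_ j (ltn_ord j) i) : forall j', (j' < d)%N -> c' j' =1 fun=> 0.
  by rewrite /c' valK.
apply: main; congr (Q _): Qc.
transitivity (\sum_(o < d) \sum_i' c (o, i') *: (f ^+ o * b i')).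
  by rewrite pair_bigA; apply: eq_bigr => -[].
apply: eq_bigr => o _; rewrite mulr_sumr.
by apply: eq_bigr => i' _; rewrite /c' valK scalerAr.
Qed.

Lemma msize_expM (f g : R) j : (msize (f ^+ j * g) <= j * msize f + msize g)%N.
Proof.
elim: j => [|j IHj]; first by rewrite expr0 mul1r.
rewrite exprS -mulrA mulSn -addnA; set q := _ * g in IHj *.
have [->|nz_f] := eqVneq f 0; first by rewrite mul0r msize0.
have [->|nz_q] := eqVneq q 0; first by rewrite mulr0 msize0.
by rewrite msizeM // (leq_trans (leq_pred _)) // leq_add2l.
Qed.

(** Each step of a chain multiplies the size of an independent family by [d],
  while degrees grow by at most [d * F], with [F] independent of [d]. *)
Lemma free_mod_chain h (Q : nat -> R -> Prop) :
  (forall i, (i <= h)%N -> is_prime_ideal (Q i)) ->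
  (forall i, (i < h)%N -> subideal (Q i) (Q i.+1) /\ ~ subideal (Q i.+1) (Q i)) ->
  exists F, forall d D (I : finType) (b : I -> R),
    free_mod (Q h) b -> (forall i, msize (b i) <= D)%N ->
    exists (I' : finType) (b' : I' -> R),
      [/\ free_mod (Q 0%N) b', #|I'| = (d ^ h * #|I|)%N
        & forall i, (msize (b' i) <= D + d * F)%N].
Proof.
elim: h => [|h IHh] prQ ltQ.
  by exists 0%N => d D I b fr leD; exists I, b; rewrite expn0 mul1n muln0 addn0.
have [s12 ns21] := ltQ h (leqnn _).
have [f nf] := not_all_ex_not _ _ ns21; have [Qf nQf] := imply_to_and _ _ nf.
have [i lei|i lti|F HF] := IHh.
- by apply: prQ; lia.
- by apply: ltQ; lia.
exists (F + msize f)%N => d D I b fr leD.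
have := HF d (D + d * msize f)%N _ _
  (free_mod_powers (d := d) (prQ _ (leqnn _)) (prQ h (leqnSn _)) s12 fr Qf nQf).
case=> [[j i] /=|I' [b' [fr' cI' leb']]].
  rewrite (leq_trans (msize_expM _ _ _)) // addnC leq_add // leq_mul2r.
  by rewrite (ltnW (ltn_ord j)) orbT.
exists I', b'; split=> // [|i].
  by rewrite cI' card_prod card_ord expnS; ring.
by rewrite (leq_trans (leb' i)) // -addnA leq_add2l mulnDr addnC.
Qed.

Lemma card_bmultinom_le D : (#|{: 'X_{1..N < D}}| <= D ^ N)%N.
Proof.
have mlt (m : 'X_{1..N < D}) i : (m i < D)%N.
  apply: leq_ltn_trans (bmdeg m); rewrite mdegE (bigD1 i) //=; exact: leq_addr.
pose g (m : 'X_{1..N < D}) := [ffun i => Ordinal (mlt m i)].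
have injg : injective g.
  move=> m m' /ffunP Eg; apply/val_inj/mnmP => i.
  by have /(congr1 val) := Eg i; rewrite !ffunE.
by rewrite (leq_trans (leq_card _ injg)) // card_ffun !card_ord.
Qed.

Lemma card_free_mod_le Q (I : finType) (b : I -> R) D :
  Q 0 -> free_mod Q b -> (forall i, msize (b i) <= D)%N -> (#|I| <= D ^ N)%N.
Proof.
move=> Q0 fr leD; apply: leq_trans (card_bmultinom_le D).
pose M := \matrix_(i < #|I|, j < #|{: 'X_{1..N < D}}|)
             (b (enum_val i))@_(enum_val j : 'X_{1..N < D}).
suff /eqP <- : row_free M by exact: rank_leq_col.
apply: inj_row_free => v vM0; apply/rowP => j; rewrite mxE.
rewrite -[j]enum_valK; apply: (fr (fun i => v 0 (enum_rank i))).
suff -> : \sum_i v 0 (enum_rank i) *: b i = 0 by [].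
apply/mpolyP => m; rewrite mcoeff0 raddf_sum /=.
have [ltm|lem] := ltnP (mdeg m) D; last first.
  apply: big1 => i _; rewrite mcoeffZ memN_msupp_eq0 ?mulr0 //.
  by apply: msize_mdeg_ge; apply: leq_trans (leD i) lem.
have /rowP/(_ (enum_rank (BMultinom ltm))) := vM0; rewrite !mxE => E0; rewrite -[RHS]E0.
rewrite (reindex _ (onW_bij _ (enum_val_bij I))) /=; apply: eq_bigr => i _.
by rewrite mcoeffZ mxE enum_valK enum_rankK.
Qed.

(** Multiplied by powers of elements that climb a chain of length [h], the given
  families reach size [d ^ (h + e)] in degree linear in [d], whereas polynomials
  of that degree in [N] variables only span a space of dimension of order
  [d ^ N]. *)
Lemma prime_height_ge_bound P h e D :
  (forall d, (0 < d)%N -> exists (I : finType) (b : I -> R),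
     [/\ free_mod P b, #|I| = (d ^ e)%N & forall i, (msize (b i) <= d * D)%N]) ->
  prime_height_ge P h -> (h + e <= N)%N.
Proof.
move=> base [Q [prQ ltQ eqQ]].
have [F HF] := free_mod_chain prQ ltQ.
(* With this choice [d ^ N.+1] exceeds [(d * (D + F)) ^ N]. *)
pose d := (((D + F) ^ N).+1)%N.
have [//|I [b [fr cI leb]]] := base d.
have frQ : free_mod (Q h) b by move=> c /eqQ; apply: fr.
have [I' [b' [fr' cI' leb']]] := HF d _ _ _ frQ leb.
have Q00 : Q 0%N 0 by have [[]] := prQ 0%N (leq0n _).
have leb'' i : (msize (b' i) <= d * (D + F))%N by rewrite mulnDr; apply: leb'.
have := card_free_mod_le Q00 fr' leb''.
rewrite cI' cI -expnD expnMn leqNgt => /negP; apply: contra_notT.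
rewrite -ltnNge => ltN; apply: (@leq_trans (d ^ N.+1)); last exact: leq_pexp2l.
rewrite expnSr ltn_pmul2l ?expn_gt0 //; exact: leqnn.
Qed.

End DimensionBound.

(** * Substitutions and toric maps *)

Section Substitution.

Variables (k : fieldType) (N : nat).
Local Notation R := {mpoly k[N]}.
Implicit Types (h : 'I_N -> R) (p : R) (m : 'X_{1..N}).

Definition subst h : R -> R := mmap (@mpolyC N k) h.

HB.instance Definition _ h :=
  GRing.RMorphism.copy (subst h) (mmap (@mpolyC N k) h).

Lemma substU h z : subst h 'X_z = h z.
Proof. by rewrite /subst mmapX mmap1U. Qed.

Lemma substM h m : subst h 'X_[m] = \prod_z h z ^+ m z.
Proof. by rewrite /subst mmapX. Qed.

Lemma substZ h c p : subst h (c *: p) = c *: subst h p.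
Proof. by rewrite /subst mmapZ mul_mpolyC. Qed.

Lemma subst_sum h (I : Type) (r : seq I) (P : pred I) (F : I -> R) :
  subst h (\sum_(i <- r | P i) F i) = \sum_(i <- r | P i) subst h (F i).
Proof. exact: raddf_sum. Qed.

Lemma substE h p : subst h p = \sum_(m <- msupp p) p@_m *: subst h 'X_[m].
Proof.
by rewrite [in LHS](mpolyE p) subst_sum; apply: eq_bigr => m _; rewrite substZ.
Qed.

Lemma eq_substX h h' m :
  (forall z, m z != 0%N -> h z = h' z) -> subst h 'X_[m] = subst h' 'X_[m].
Proof.
move=> eqh; rewrite !substM; apply: eq_bigr => z _.
by have [-> | /eqh ->] := eqVneq (m z) 0%N; rewrite ?expr0.
Qed.

Lemma eq_subst h h' : h =1 h' -> subst h =1 subst h'.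
Proof.
move=> eqh p; rewrite substE [RHS]substE; apply: eq_bigr => m _.
by congr (_ *: _); apply: eq_substX => z _; apply: eqh.
Qed.

Lemma subst_comp h h' p : subst h' (subst h p) = subst (fun z => subst h' (h z)) p.
Proof.
rewrite [subst h p]substE subst_sum [RHS]substE; apply: eq_bigr => m _.
rewrite substZ !substM rmorph_prod; congr (_ *: _).
by apply: eq_bigr => z _; rewrite rmorphXn.
Qed.

Lemma subst_ker_prime h : is_prime_ideal (fun p => subst h p = 0).
Proof.
split; first split.
- exact: rmorph0.
- by move=> p q; rewrite rmorphD /= => -> ->; rewrite addr0.
- by move=> a p; rewrite rmorphM /= => ->; rewrite mulr0.
- by rewrite rmorph1 => /eqP; rewrite oner_eq0.
- move=> p q; rewrite rmorphM /= => /eqP; rewrite mulf_eq0.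
  by case/orP => /eqP; [left | right].
Qed.

(** In a vanishing combination of the monomials [X_(E m)] the coefficients add
  up to zero on each fibre of [E], so any function of [E m] may replace the
  monomial. *)
Lemma sum_fibres_eq0 (s : seq 'X_{1..N}) (c : 'X_{1..N} -> k)
    (E : 'X_{1..N} -> 'X_{1..N}) (V : lmodType k) (g : 'X_{1..N} -> V) :
  \sum_(m <- s) c m *: 'X_[E m] = 0 :> R -> \sum_(m <- s) c m *: g (E m) = 0.
Proof.
move=> c0; pose U := undup [seq E m | m <- s].
have pick m : m \in s -> g (E m) = \sum_(w <- U) (E m == w)%:R *: g w.
  move=> sm; have UE : E m \in U by rewrite mem_undup map_f.
  rewrite (bigD1_seq (E m)) ?undup_uniq //= eqxx scale1r.
  by rewrite big1 ?addr0 // => w; rewrite eq_sym => /negPf ->; rewrite scale0r.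
transitivity (\sum_(w <- U) (\sum_(m <- s) c m * (E m == w)%:R) *: g w).
  rewrite big_seq (eq_bigr (fun m => \sum_(w <- U) (c m * (E m == w)%:R) *: g w)).
    rewrite -big_seq exchange_big; apply: eq_bigr => w _.
    by rewrite scaler_suml.
  move=> m sm; rewrite pick // scaler_sumr.
  by apply: eq_bigr => w _; rewrite scalerA.
rewrite big1 // => w _; have /(congr1 (mcoeff w)) := c0.
rewrite mcoeff0 raddf_sum /= => c0w.
suff -> : \sum_(m <- s) c m * (E m == w)%:R = 0 by rewrite scale0r.
by rewrite -[RHS]c0w; apply: eq_bigr => m _; rewrite mcoeffZ mcoeffX.
Qed.

End Substitution.

Section Toric.

Variables (k : fieldType) (n : nat).
Local Notation R := {mpoly k[n + n]}.
Implicit Types (rho : 'I_n -> 'I_n) (m : 'X_{1..n + n}).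

Definition toric rho (z : 'I_(n + n)) : R :=
  match split z with
  | inl v => xvar k v
  | inr v => xvar k v * yvar k (rho v)
  end.

Definition toric_exp rho m : 'X_{1..n + n} :=
  [multinom match split z with
            | inl v => m (lshift n v) + m (rshift n v)
            | inr r => \sum_(w | rho w == r) m (rshift n w)
            end | z < n + n]%N.

Lemma split_lshift (v : 'I_n) : split (lshift n v) = inl v.
Proof. exact: (unsplitK (inl v)). Qed.

Lemma split_rshift (v : 'I_n) : split (rshift n v) = inr v.
Proof. exact: (unsplitK (inr v)). Qed.

Lemma toric_expL rho m v :
  toric_exp rho m (lshift n v) = (m (lshift n v) + m (rshift n v))%N.
Proof. by rewrite mnmE split_lshift. Qed.

Lemma toric_expR rho m r :
  toric_exp rho m (rshift n r) = (\sum_(w | rho w == r) m (rshift n w))%N.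
Proof. by rewrite mnmE split_rshift. Qed.

Lemma toricX rho m : subst (toric rho) 'X_[m] = 'X_[toric_exp rho m] :> R.
Proof.
rewrite substM [RHS]mpolyXE_id !big_split_ord /=.
transitivity ((\prod_v xvar k v ^+ m (lshift n v)) *
   ((\prod_v xvar k v ^+ m (rshift n v)) *
    (\prod_v yvar k (rho v) ^+ m (rshift n v)))).
  rewrite -[X in _ = _ * X]big_split; congr (_ * _); apply: eq_bigr => v _.
    by rewrite /toric split_lshift.
  by rewrite /toric split_rshift exprMn.
rewrite mulrA -big_split; congr (_ * _).
  by apply: eq_bigr => v _; rewrite toric_expL exprD.
rewrite (partition_big rho xpredT) //=; apply: eq_bigr => r _.
rewrite toric_expR -prodrXr; apply: eq_bigr => w /eqP -> //.
Qed.

(** The exponents of [x_v] and [y_v] can be read off from those of [u_v] and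
  [t_v], the map being [x_v = u_v], [y_v = u_v t_v]. *)
Lemma toric_id_inj (p : R) : subst (toric id) p = 0 -> p = 0.
Proof.
rewrite substE => p0; rewrite [p]mpolyE.
pose back (w : 'X_{1..n + n}) : 'X_{1..n + n} :=
  [multinom match split z with
            | inl v => w (lshift n v) - w (rshift n v)
            | inr v => w (rshift n v)
            end | z < n + n]%N.
have backK m : back (toric_exp id m) = m.
  have sumR v : (\sum_(w | w == v) m (rshift n w))%N = m (rshift n v).
    by rewrite big_pred1_eq.
  apply/mnmP => z; rewrite mnmE; case: (splitP z) => v Ez.
    by rewrite toric_expL toric_expR sumR addnK; congr (m _); exact: val_inj.
  by rewrite toric_expR sumR; congr (m _); exact: val_inj.
have := @sum_fibres_eq0 k _ (msupp p) (fun m => p@_m) (toric_exp id)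
  R (fun w => 'X_[back w]).
have E m : 'X_[back (toric_exp id m)] = 'X_[m] :> R by rewrite backK.
under eq_bigr do rewrite -toricX.
by move/(_ p0); under eq_bigr do rewrite E.
Qed.

End Toric.

(** * The primes of vertex sets and their heights *)

Section GraphPrimes.

Variables (n : nat) (e : rel 'I_n) (k : fieldType).
Hypothesis e_sym : ssrbool.symmetric e.
Local Notation R := {mpoly k[n + n]}.
Local Notation x := (xvar k).
Local Notation y := (yvar k).
Implicit Types (S : {set 'I_n}) (T : {set 'I_(n + n)}).

(** The variables that the parametrization substitutes away.  Their number
  [|S| + n - c(S)] is the height of the prime. *)
Definition killed S : {set 'I_(n + n)} :=
  [set z | match split z with
           | inl v => v \in S
           | inr v => (v \in S) || (component e S v != v)
           end].

(** The parametrization in which only the variables in [T] have been substituted;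
  the codomain reuses [x_v] for [u_v] and [y_v] for [t_v].  For empty [T] it is
  injective, for [T = killed S] it defines the prime of [S]. *)
Definition partial_param S T (z : 'I_(n + n)) : R :=
  match split z with
  | inl v => if z \in T then 0 else x v
  | inr v => if v \in S then if z \in T then 0 else y v
             else x v * y (if z \in T then component e S v else v)
  end.

Definition graph_prime S (p : R) : Prop := subst (partial_param S (killed S)) p = 0.

Lemma killedL S v : (lshift n v \in killed S) = (v \in S).
Proof. by rewrite inE split_lshift. Qed.

Lemma killedR S v :
  (rshift n v \in killed S) = (v \in S) || (component e S v != v).
Proof. by rewrite inE split_rshift. Qed.

Lemma killed_card S :
  (#|killed S| + #|[set v | v \notin S & component e S v == v]| = n + #|S|)%N.
Proof.
set C := [set v | _ & _].
have -> : killed S = [set lshift n v | v in S] :|: [set rshift n v | v in ~: C].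
  apply/setP => z; rewrite -[z]splitK; case: (split z) => v /=; rewrite !inE.
    rewrite split_lshift mem_imset; last exact: lshift_inj.
    by rewrite orbC; case: imsetP => // -[w _ /eqP]; rewrite eq_lrshift.
  rewrite split_rshift (mem_imset _ _ (@rshift_inj n n)).
  rewrite !inE negb_and negbK.
  by case: imsetP => // -[w _ /eqP]; rewrite eq_rlshift.
rewrite cardsU (_ : _ :&: _ = set0) ?cards0 ?subn0.
  rewrite !card_imset; [|exact: rshift_inj | exact: lshift_inj].
  by rewrite -addnA [(#|~: C| + _)%N]addnC cardsC card_ord addnC.
apply/setP => z; rewrite !inE; apply/negP => /andP[/imsetP[v _ ->] /imsetP[w _ /eqP]].
by rewrite eq_lrshift.
Qed.

Lemma partial_paramL S T v :
  partial_param S T (lshift n v) = if lshift n v \in T then 0 else x v.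
Proof. by rewrite /partial_param split_lshift. Qed.

Lemma partial_paramR S T v :
  partial_param S T (rshift n v) =
    if v \in S then if rshift n v \in T then 0 else y v
    else x v * y (if rshift n v \in T then component e S v else v).
Proof. by rewrite /partial_param split_rshift. Qed.

Lemma graph_prime_prime S : is_prime_ideal (graph_prime S).
Proof. exact: subst_ker_prime. Qed.

(** Substituting more variables factors through substituting fewer, because the
  replacing variable [t_(component v)] is itself never substituted. *)
Lemma partial_param_trans S T T' (p : R) : T \subset T' -> T' \subset killed S ->
  subst (partial_param S T) p = 0 -> subst (partial_param S T') p = 0.
Proof.
move=> /subsetP sTT' /subsetP sT'K p0.
pose tau (z : 'I_(n + n)) : R :=
  match split z with
  | inl v => if z \in T' then 0 else x v
  | inr v => if z \in T' then if v \in S then 0 else y (component e S v) else y v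
  end.
have tauL v : tau (lshift n v) = if lshift n v \in T' then 0 else x v.
  by rewrite /tau split_lshift.
have tauR v : tau (rshift n v) = if rshift n v \in T' then
    if v \in S then 0 else y (component e S v) else y v.
  by rewrite /tau split_rshift.
have LT' v : v \notin S -> (lshift n v \in T') = false.
  by move=> vS; apply/negP => /sT'K; rewrite killedL (negPf vS).
have comp z : subst tau (partial_param S T z) = partial_param S T' z.
  rewrite -[z]splitK; case: (split z) => v /=.
    rewrite !partial_paramL; case: ifP => [/sTT' -> | _]; first exact: rmorph0.
    by rewrite substU tauL.
  rewrite !partial_paramR; case: ifPn => vS.
    case: ifP => [/sTT' -> | _]; first exact: rmorph0.
    by rewrite substU tauR vS.
  rewrite rmorphM /= !substU tauL LT' // tauR; congr (_ * _).
  case: (boolP (rshift n v \in T)) => [/sTT' -> | _].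
    case: ifP => // /sT'K; rewrite killedR componentK // eqxx orbF => cS.
    by have := component_notin e vS; rewrite cS.
  by case: ifP => _; rewrite ?(negPf vS).
have := congr1 (subst tau) p0; by rewrite subst_comp rmorph0 (eq_subst comp).
Qed.

(** The further substitution [t_v = u_v t_v] for [v] in [S] turns the map into
  the monomial one that treats all vertices alike. *)
Lemma partial_param0_inj S (p : R) : subst (partial_param S set0) p = 0 -> p = 0.
Proof.
move=> p0; apply: toric_id_inj.
pose tau (z : 'I_(n + n)) : R :=
  match split z with inl v => x v | inr v => if v \in S then x v * y v else y v end.
have tauL v : tau (lshift n v) = x v by rewrite /tau split_lshift.
have tauR v : tau (rshift n v) = if v \in S then x v * y v else y v.
  by rewrite /tau split_rshift.
have comp z : subst tau (partial_param S set0 z) = toric k id z.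
  rewrite -[z]splitK /toric unsplitK; case: (split z) => v /=.
    by rewrite partial_paramL inE substU tauL.
  rewrite partial_paramR !inE; case: ifP => vS; first by rewrite substU tauR vS.
  by rewrite rmorphM /= !substU tauL tauR vS.
have := congr1 (subst tau) p0; by rewrite subst_comp rmorph0 (eq_subst comp).
Qed.

(** The variable [z] itself when [z] is sent to zero, and the binomial of [v] and
  the root of its component when [z = t_v]. *)
Lemma partial_param_witness S z : z \in killed S -> exists w, forall T,
  T \subset killed S -> subst (partial_param S T) w = 0 <-> z \in T.
Proof.
have X0 (u : 'I_(n + n)) : ('X_u : R) != 0.
  by rewrite -msupp_eq0 msuppX.
have X0' (u : 'I_(n + n)) : ('X_u : R) = 0 -> False by move/eqP; rewrite (negPf (X0 u)).
rewrite -[z]splitK; case: (split z) => v /=.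
  rewrite killedL => vS; exists (x v) => T sT.
  by rewrite substU partial_paramL; case: ifP => // _; split=> // /X0'.
rewrite killedR; have [vS _|vS /= nroot] := boolP (v \in S).
  exists (y v) => T sT; rewrite substU partial_paramR vS.
  by case: ifP => // _; split=> // /X0'.
exists (edge_binomial k v (component e S v)) => T /subsetP sT.
have LT u : u \notin S -> (lshift n u \in T) = false.
  by move=> uS; apply/negP => /sT; rewrite killedL (negPf uS).
have cS := component_notin e vS.
rewrite /edge_binomial rmorphB !rmorphM /= !substU !partial_paramL !partial_paramR.
rewrite !LT // (negPf vS) (negPf cS) componentK // if_same.
set r := component e S v in nroot *.
have -> : x v * (x r * y r) - x r * (x v * y (if rshift n v \in T then r else v))
        = x v * x r * (y r - y (if rshift n v \in T then r else v)) by ring.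
case: ifP => _; first by rewrite subrr mulr0.
split=> // /eqP; rewrite !mulf_eq0 !(negPf (X0 _)) /= subr_eq0 => /eqP.
move=> /(congr1 (mcoeff U_(rshift n r))); rewrite !mcoeffX eqxx eq_mnm1 eq_rshift.
by rewrite eq_sym (negPf nroot) => /eqP; rewrite oner_eq0.
Qed.

Lemma graph_prime_height_ge S : prime_height_ge (graph_prime S) #|killed S|.
Proof.
pose L := enum (killed S); pose T i := [set z in take i L].
have TE i z : (z \in T i) = (z \in take i L) by rewrite inE.
have sT i : T i \subset killed S.
  by apply/subsetP => z; rewrite TE => /mem_take; rewrite mem_enum.
exists (fun i p => subst (partial_param S (T i)) p = 0); split.
- by move=> i _; apply: subst_ker_prime.
- rewrite cardE -/L => i lti.
  have [z0 _] : exists z0, z0 \in L.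
    by case: (L) lti => [//|z0 L' _]; exists z0; rewrite mem_head.
  pose z := nth z0 L i; have Lz : z \in L by rewrite mem_nth.
  have sTT : T i \subset T i.+1.
    by apply/subsetP => u; rewrite !TE (take_nth z0) // mem_rcons inE orbC => ->.
  split=> [p|sub]; first exact: partial_param_trans.
  have [|w Hw] := @partial_param_witness S z; first by rewrite -mem_enum.
  have /(Hw _ (sT i)) : subst (partial_param S (T i)) w = 0.
    by apply: sub; apply/Hw => //; rewrite TE (take_nth z0) // mem_rcons mem_head.
  rewrite TE => zi; have := enum_uniq (killed S).
  rewrite -/L -(cat_take_drop i.+1 L) cat_uniq (take_nth z0) // rcons_uniq -/z.
  by rewrite zi.
- have -> : T #|killed S| = killed S.
    by apply/setP => z; rewrite TE cardE take_size mem_enum.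
  by [].
Qed.

(** Monomials in the variables outside [killed S] stay independent modulo the
  prime: on them the parametrization agrees with the injective one. *)
Lemma graph_prime_height_le S h :
  prime_height_ge (graph_prime S) h -> (h <= #|killed S|)%N.
Proof.
pose W := {z | z \notin killed S}.
have cW : (#|killed S| + #|{: W}| = n + n)%N.
  by rewrite card_sig -[RHS]card_ord -(cardC (mem (killed S))).
suff base d : (0 < d)%N -> exists (I : finType) (b : I -> R),
    [/\ free_mod (graph_prime S) b, #|I| = (d ^ #|{: W}|)%N
      & forall i, (msize (b i) <= d * (n + n).+1)%N].
  by move/(prime_height_ge_bound base); rewrite -[X in (_ <= X)%N]cW leq_add2r.
move=> d0; pose I := {ffun W -> 'I_d}.
pose mon (f : I) : 'X_{1..n + n} :=
  [multinom if insub z is Some w then f w : nat else 0%N | z < n + n].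
have monW f w : mon f (val w) = f w by rewrite mnmE valK.
have inj_mon : injective mon.
  by move=> f f' Eff'; apply/ffunP => w; apply/val_inj; rewrite /= -!monW Eff'.
exists I, (fun f => 'X_[mon f]); split.
- move=> c; rewrite /graph_prime => Pc.
  have /partial_param0_inj c0 : subst (partial_param S set0) (\sum_f c f *: 'X_[mon f]) = 0.
    rewrite -[RHS]Pc !subst_sum; apply: eq_bigr => f _; rewrite !substZ; congr (_ *: _).
    apply: eq_substX => z; rewrite mnmE; case: insubP => // w zK _ _.
    rewrite -[z]splitK in zK *; case: (split z) zK => v /= zK.
      by rewrite !partial_paramL (negPf zK) inE.
    rewrite !partial_paramR (negPf zK) inE; case: ifP => // _.
  move=> f; have /(congr1 (mcoeff (mon f))) := c0.
  rewrite mcoeff0 raddf_sum /= => E; rewrite -[RHS]E (bigD1 f) //= mcoeffZ mcoeffX eqxx mulr1.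
  rewrite big1 ?addr0 // => f' nf'.
  by rewrite mcoeffZ mcoeffX (inj_eq inj_mon) (negPf nf') mulr0.
- by rewrite card_ffun card_ord.
- move=> f; rewrite msizeX mdegE.
  have le1 z : (mon f z <= d)%N.
    by rewrite mnmE; case: insub => // w; apply: ltnW.
  apply: (@leq_ltn_trans (\sum_(z < n + n) d)); first exact: leq_sum.
  by rewrite sum_nat_const card_ord; nia.
Qed.

Lemma graph_prime_height S : prime_height (graph_prime S) #|killed S|.
Proof.
split; first exact: graph_prime_height_ge.
by move/graph_prime_height_le; rewrite ltnn.
Qed.

End GraphPrimes.

(** * Generators of the primes of vertex sets *)

Section Ideals.

Variable S : comNzRingType.
Implicit Types (I : S -> Prop).

Lemma ideal_sum I (T : eqType) (r : seq T) (F : T -> S) :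
  is_ideal I -> (forall i, i \in r -> I (F i)) -> I (\sum_(i <- r) F i).
Proof.
case=> I0 ID IM; elim: r => [|i r IHr] Ir; first by rewrite big_nil.
rewrite big_cons; apply: ID; first by apply: Ir; rewrite mem_head.
by apply: IHr => j rj; apply: Ir; rewrite inE rj orbT.
Qed.

Lemma ideal_gen_ideal (A : S -> Prop) : is_ideal (ideal_gen A).
Proof.
split.
- by exists [::]; rewrite ?big_nil.
- move=> _ _ [cs As ->] [ds Ad ->]; exists (cs ++ ds); last by rewrite big_cat.
  by move=> c; rewrite mem_cat => /orP[/As|/Ad].
- move=> a _ [cs As ->]; exists [seq (a * c.1, c.2) | c <- cs].
    by move=> _ /mapP[c /As Ac ->].
  by rewrite big_map mulr_sumr; apply: eq_bigr => c _; rewrite mulrA.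
Qed.

Lemma ideal_gen_sub (A : S -> Prop) I :
  is_ideal I -> (forall a, A a -> I a) -> subideal (ideal_gen A) I.
Proof.
move=> idI AI _ [cs As ->]; apply: ideal_sum => // c /As/AI Ic.
by case: idI => _ _; apply.
Qed.

Lemma ideal_gen_mem (A : S -> Prop) a : A a -> ideal_gen A a.
Proof.
move=> Aa; exists [:: (1, a)]; last by rewrite big_seq1 mul1r.
by move=> c; rewrite inE => /eqP ->.
Qed.

End Ideals.

Section ToricGenerators.

Variables (n : nat) (e : rel 'I_n) (k : fieldType).
Hypothesis e_sym : ssrbool.symmetric e.
Local Notation R := {mpoly k[n + n]}.
Local Notation x := (xvar k).
Local Notation y := (yvar k).
Local Notation f := (edge_binomial k).
Local Notation ul v := U_(lshift n v)%MM.
Local Notation ur v := U_(rshift n v)%MM.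
Implicit Types (S : {set 'I_n}) (rho : 'I_n -> 'I_n) (m : 'X_{1..n + n}).

Definition avoids S m :=
  [forall v in S, (m (lshift n v) == 0%N) && (m (rshift n v) == 0%N)].

Lemma toric_expD rho m m' :
  toric_exp rho (m + m')%MM = (toric_exp rho m + toric_exp rho m')%MM.
Proof.
apply/mnmP => z; rewrite mnmDE -[z]splitK; case: (split z) => v /=.
  by rewrite !toric_expL !mnmDE addnACA.
by rewrite !toric_expR -big_split; apply: eq_bigr => w _; rewrite mnmDE.
Qed.

Lemma toric_exp_ul rho v : toric_exp rho (ul v) = ul v.
Proof.
apply/mnmP => z; rewrite -[z]splitK; case: (split z) => w /=.
  by rewrite toric_expL !mnm1E eq_lrshift addn0.
by rewrite toric_expR !mnm1E eq_lrshift big1 // => i _; rewrite mnm1E eq_lrshift.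
Qed.

Lemma toric_exp_ur rho v : toric_exp rho (ur v) = (ul v + ur (rho v))%MM.
Proof.
apply/mnmP => z; rewrite -[z]splitK; case: (split z) => w /=.
  by rewrite toric_expL mnmDE !mnm1E !eq_rlshift eq_rshift eq_lshift addn0.
rewrite toric_expR mnmDE !mnm1E eq_lrshift eq_rshift add0n.
under eq_bigr do rewrite mnm1E eq_rshift.
rewrite big_mkcond (bigD1 v) //= eqxx big1 => [|u]; first by case: eqP.
by rewrite eq_sym => /negPf ->; case: ifP.
Qed.

Section Exchange.

Variables (S : {set 'I_n}) (L : R -> Prop).
Hypotheses (idL : is_ideal L)
  (Lf : forall i j, i \notin S -> j \notin S -> connect (deletion e S) i j ->
        L (f i j)).
Local Notation rt := (component e S).

(** Two monomials with the same image under the parametrization are linked by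
  exchanges [y_i x_j -> x_i y_j] inside a component, each of which reduces the
  excess of the [y]-exponents of the first over those of the second. *)
Lemma exchange m m' :
  avoids S m -> avoids S m' -> toric_exp rt m = toric_exp rt m' ->
  L ('X_[m] - 'X_[m']).
Proof.
move=> + av' +; have [d] := ubnP (\sum_v (m (rshift n v) - m' (rshift n v)))%N.
elim: d m => [//|d IHd] m ltd av Em.
have EL v : (m (lshift n v) + m (rshift n v) = m' (lshift n v) + m' (rshift n v))%N.
  by rewrite -!(toric_expL rt) Em.
have ER r : (\sum_(w | rt w == r) m (rshift n w) = \sum_(w | rt w == r) m' (rshift n w))%N.
  by rewrite -!(toric_expR rt) Em.
(* If no [y]-exponent of [m] exceeds that of [m'], the equal sums over the
   components force equality.  Otherwise the component of an excess [i] also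
   contains a deficit [j]. *)
have [/existsP[i lti]|] := boolP [exists i, m' (rshift n i) < m (rshift n i)]%N; last first.
  rewrite negb_exists => /forallP le; suff -> : m = m'.
    by rewrite subrr; case: idL.
  have le' v : (m (rshift n v) <= m' (rshift n v))%N by rewrite leqNgt.
  have Er v : m (rshift n v) = m' (rshift n v).
    have [_] := leqif_sum (fun w (_ : rt w == rt v) => leqif_eq (le' w)).
    by rewrite ER eqxx => /esym/forall_inP/(_ v (eqxx _))/eqP.
  apply/mnmP => z; rewrite -[z]splitK; case: (split z) => v /=; last exact: Er.
  by have := EL v; rewrite Er; lia.
have [/existsP[j /andP[/eqP rtj ltj]]|] :=
    boolP [exists j, (rt j == rt i) && (m (rshift n j) < m' (rshift n j))%N]; last first.
  rewrite negb_exists => /forallP ge.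
  have ge' w : rt w == rt i -> (m' (rshift n w) <= m (rshift n w))%N.
    by move=> rtw; have := ge w; rewrite rtw /= -leqNgt.
  have [_] := leqif_sum (fun w rtw => leqif_eq (ge' w rtw)).
  rewrite ER eqxx => /esym/forall_inP/(_ i (eqxx _))/eqP Ei.
  by rewrite Ei ltnn in lti.
have iS : i \notin S.
  by apply/negP => iS; move: lti; have /forall_inP/(_ i iS)/andP[_ /eqP ->] := av.
have jS : j \notin S.
  by apply/negP => jS; move: ltj; have /forall_inP/(_ j jS)/andP[_ /eqP ->] := av'.
have cij : connect (deletion e S) j i by rewrite -eq_component // rtj.
have neqij : i != j by apply/negP => /eqP Eij; move: lti ltj; rewrite Eij; lia.
pose q := (m - (ur i + ul j))%MM.
have Eq : m = (q + (ur i + ul j))%MM.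
  apply/esym/submK/mnm_lepP => z; rewrite mnmDE !mnm1E.
  rewrite -[z]splitK; case: (split z) => v /=.
    rewrite eq_rlshift eq_lshift; case: eqP => // <-.
    by have := EL j; lia.
  by rewrite eq_lrshift eq_rshift; case: eqP => // <-; lia.
pose m1 := (q + (ul i + ur j))%MM.
have X_m1 : 'X_[m] - 'X_[m1] = 'X_[q] * f j i :> R.
  by rewrite Eq /m1 !mpolyXD /edge_binomial /xvar /yvar; ring.
have -> : 'X_[m] - 'X_[m'] = 'X_[q] * f j i + ('X_[m1] - 'X_[m']) :> R.
  by rewrite -X_m1; ring.
have Lji := Lf jS iS cij; have mR v : m (rshift n v) = (q (rshift n v) + (i == v))%N.
  by rewrite {1}Eq !mnmDE !mnm1E eq_lrshift eq_rshift addn0.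
have m1R v : m1 (rshift n v) = (q (rshift n v) + (j == v))%N.
  by rewrite !mnmDE !mnm1E eq_lrshift eq_rshift.
case: (idL) => _ LD LM; apply: LD; first exact: LM.
apply: IHd.
- rewrite ltnS in ltd; apply: leq_trans ltd; rewrite (bigD1 i) //=.
  rewrite [in X in (_ < X)%N](bigD1 i) //= -addSn; apply: leq_add.
    by rewrite m1R mR eqxx eq_sym (negPf neqij); have := mR i; rewrite eqxx; lia.
  apply: leq_sum => v nvi; rewrite m1R mR [i == v]eq_sym (negPf nvi) addn0.
  by have [<-|_] := eqVneq j v; [have := mR j; rewrite (negPf neqij); lia | rewrite addn0].
- apply/forall_inP => v vS; have /forall_inP/(_ v vS) := av.
  rewrite Eq /m1 !mnmDE !mnm1E !eq_lrshift !eq_rlshift !eq_lshift !eq_rshift.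
  have /negPf -> : i != v by apply: contraNneq iS => ->.
  have /negPf -> : j != v by apply: contraNneq jS => ->.
  by [].
- rewrite -Em Eq /m1 !toric_expD !toric_exp_ul !toric_exp_ur rtj.
  by congr (_ + _)%MM; rewrite -addmA; congr (_ + _)%MM; rewrite addmC.
Qed.

End Exchange.

(** The parametrization kills the monomials that involve [S] and sends the others
  to monomials.  Replacing each by a chosen one with the same image changes a
  polynomial by exchanges only, and sends elements of the kernel to zero. *)
Lemma graph_prime_gens S (L : R -> Prop) :
  is_ideal L -> (forall s, s \in S -> L (x s) /\ L (y s)) ->
  (forall i j, i \notin S -> j \notin S -> connect (deletion e S) i j -> L (f i j)) ->
  subideal (graph_prime e S) L.
Proof.
move=> idL LS Lf p Pp; have [L0 LD LM] := idL.
pose rt := component e S; pose s := [seq m <- msupp p | avoids S m].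
have LX m z : m z != 0%N -> L 'X_z -> L 'X_[m].
  rewrite -lep1mP => /submK <-; rewrite mpolyXD; exact: LM.
have bad m : ~~ avoids S m -> L 'X_[m] /\ graph_prime e S ('X_[m] : R).
  case/forall_inPn => v vS; rewrite negb_and.
  have [Lx Ly] := LS v vS.
  have kill z : m z != 0%N -> partial_param e k S (killed e S) z = 0 ->
      graph_prime e S ('X_[m] : R).
    rewrite -lep1mP => /submK <- z0.
    by rewrite /graph_prime mpolyXD rmorphM /= substU z0 mulr0.
  case/orP=> nz; (split; first exact: LX nz _); apply: kill nz _.
    by rewrite partial_paramL killedL vS.
  by rewrite partial_paramR killedR vS.
have good m : avoids S m ->
    subst (partial_param e k S (killed e S)) 'X_[m] = 'X_[toric_exp rt m].
  move=> av; rewrite -toricX; apply: eq_substX => z.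
  rewrite -[z]splitK /toric unsplitK; case: (split z) => v /= nz.
    rewrite partial_paramL killedL ifN //; apply: contraNN nz => vS.
    by have /forall_inP/(_ v vS)/andP[] := av.
  have vS : v \notin S.
    by apply: contraNN nz => vS; have /forall_inP/(_ v vS)/andP[] := av.
  rewrite partial_paramR killedR (negPf vS) /= /rt; congr (_ * yvar _ _).
  by case: eqP.
have split_p (g : 'X_{1..n + n} -> R) : \sum_(m <- msupp p) g m =
    \sum_(m <- s) g m + \sum_(m <- [seq m <- msupp p | ~~ avoids S m]) g m.
  by rewrite !big_filter (bigID (avoids S)).
have s0 : \sum_(m <- s) p@_m *: 'X_[toric_exp rt m] = 0 :> R.
  move: Pp; rewrite /graph_prime substE split_p.
  rewrite [X in _ + X]big1_seq ?addr0 => [E|m].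
    rewrite -[RHS]E big_seq [RHS]big_seq; apply: eq_bigr => m.
    by rewrite mem_filter => /andP[av _]; rewrite good.
  by rewrite mem_filter /= => /andP[/bad[_ ->]]; rewrite scaler0.
(* A chosen monomial of [s] with image [w]; the default value is not met on
   images of members of [s]. *)
pose nf w := nth 0%MM [seq m <- s | toric_exp rt m == w] 0.
have nfP m : m \in s -> (nf (toric_exp rt m) \in s) /\
    toric_exp rt (nf (toric_exp rt m)) = toric_exp rt m.
  move=> sm; have : nf (toric_exp rt m) \in [seq m' <- s | toric_exp rt m' == toric_exp rt m].
    by apply: mem_nth; rewrite size_filter -has_count; apply/hasP; exists m.
  by rewrite mem_filter => /andP[/eqP].
have nf0 := sum_fibres_eq0 (fun w => 'X_[nf w] : R) s0.
rewrite [p]mpolyE split_p -[X in X + _]subr0 -[X in _ - X + _]nf0.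
have LZ c q : L q -> L (c *: q) by rewrite -mul_mpolyC; apply: LM.
apply: LD; last first.
  by apply: ideal_sum => // m; rewrite mem_filter => /andP[/bad[Lm _] _]; apply: LZ.
rewrite -sumrB; apply: ideal_sum => // m sm; rewrite -scalerBr; apply: LZ.
have [snf Enf] := nfP m sm; apply: (exchange idL Lf) => //.
  by move: sm; rewrite mem_filter => /andP[].
by move: snf; rewrite mem_filter => /andP[].
Qed.

End ToricGenerators.

(** * Cut sets and associated primes *)

Section CutSets.

Variables (n : nat) (e : rel 'I_n) (k : fieldType).
Hypothesis e_sym : ssrbool.symmetric e.
Local Notation R := {mpoly k[n + n]}.
Local Notation x := (xvar k).
Local Notation y := (yvar k).
Local Notation f := (edge_binomial k).
Local Notation J := (binomial_edge_ideal k e).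
Implicit Types (S : {set 'I_n}).

Lemma J_edge u v : e u v -> J (f u v).
Proof. by move=> euv; apply: ideal_gen_mem; exists u, v. Qed.

(** The identities [x_v f_iw = x_w f_iv + x_i f_vw] and
  [y_v f_iw = y_w f_iv + y_i f_vw] propagate the binomials along walks, as soon
  as one of [x_v], [y_v] can be cancelled at each vertex of the walk. *)
Lemma edge_binomial_walk S (I : R -> Prop) i j :
  is_ideal I -> (forall u v, e u v -> I (f u v)) ->
  (forall v, v \notin S ->
     (forall b, I (x v * b) -> I b) \/ (forall b, I (y v * b) -> I b)) ->
  i \notin S -> connect (deletion e S) i j -> I (f i j).
Proof.
move=> [I0 ID IM] If canc iS; move: j; apply: connect_ind.
  by rewrite /edge_binomial subrr.
move=> v w civ Iiv /and3P[evw vS _]; case: (canc v vS); apply.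
  have -> : x v * f i w = x w * f i v + x i * f v w by rewrite /edge_binomial; ring.
  by apply: ID; apply: IM => //; apply: If.
have -> : y v * f i w = y w * f i v + y i * f v w by rewrite /edge_binomial; ring.
by apply: ID; apply: IM => //; apply: If.
Qed.

Lemma subst_binomial h i j : subst h (f i j) =
  h (lshift n i) * h (rshift n j) - h (lshift n j) * h (rshift n i).
Proof. by rewrite rmorphB !rmorphM /= !substU. Qed.

Lemma graph_prime_var S s : s \in S -> graph_prime e S (x s) /\ graph_prime e S (y s).
Proof.
move=> sS; rewrite /graph_prime !substU partial_paramL partial_paramR.
by rewrite killedL killedR sS.
Qed.

Lemma paramL S v : v \notin S -> partial_param e k S (killed e S) (lshift n v) = x v.
Proof. by move=> vS; rewrite partial_paramL killedL (negPf vS). Qed.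

Lemma paramR S v : v \notin S ->
  partial_param e k S (killed e S) (rshift n v) = x v * y (component e S v).
Proof.
move=> vS; rewrite partial_paramR killedR (negPf vS) /=.
by congr (_ * yvar _ _); case: eqP.
Qed.

Lemma var_neq0 z : ('X_z : R) != 0.
Proof. by rewrite -msupp_eq0 msuppX. Qed.

Lemma graph_prime_xvar S v : v \notin S -> ~ graph_prime e S (x v).
Proof.
by move=> vS; rewrite /graph_prime substU paramL //; apply/eqP/var_neq0.
Qed.

Lemma graph_prime_binomial S i j : i \notin S -> j \notin S ->
  graph_prime e S (f i j) <-> connect (deletion e S) i j.
Proof.
move=> iS jS; rewrite /graph_prime subst_binomial !paramL // !paramR //.
rewrite -eq_component //; set a := component e S i; set b := component e S j.
have -> : x i * (x j * y b) - x j * (x i * y a) = x i * x j * (y b - y a) by ring.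
split=> [/eqP|/eqP ->]; last by rewrite subrr mulr0.
rewrite !mulf_eq0 !(negPf (var_neq0 _)) /= subr_eq0 => /eqP.
move/(congr1 (mcoeff U_(rshift n a))); rewrite !mcoeffX eqxx eq_mnm1 eq_rshift.
by rewrite eq_sym; case: eqP => // _ /eqP; rewrite eq_sym oner_eq0.
Qed.

Lemma graph_prime_binomial_in S i j :
  (i \in S) || (j \in S) || connect (deletion e S) i j -> graph_prime e S (f i j).
Proof.
have [_ ID IM] : is_ideal (graph_prime e S : R -> Prop).
  by case: (graph_prime_prime e k S).
have [iS _|iS] := boolP (i \in S).
  have [xi yi] := graph_prime_var iS; rewrite /edge_binomial -mulNr.
  by apply: ID; [rewrite mulrC|]; apply: IM.
have [jS _|jS /= c] := boolP (j \in S).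
  have [xj yj] := graph_prime_var jS.
  rewrite /edge_binomial -mulrN mulrC [X in _ + X]mulrC.
  by apply: ID; [rewrite mulrC|]; apply: IM.
exact/graph_prime_binomial.
Qed.

Lemma J_sub_graph_prime S : subideal J (graph_prime e S).
Proof.
apply: ideal_gen_sub; first by case: (graph_prime_prime e k S).
move=> _ [i [j [eij ->]]]; apply: graph_prime_binomial_in.
have [//|iS] := boolP (i \in S); have [//|jS] := boolP (j \in S).
by apply/connect1; rewrite /deletion eij iS.
Qed.

(** At a cut set [S] the ideal [J] already becomes [graph_prime S] after
  inverting elements outside that prime: binomials inside a component are
  reached along walks, and if [a], [b] are neighbours of [s] in different
  components then [f_ab x_s] and [f_ab y_s] lie in [(f_sa, f_sb)].  Since
  [graph_prime S] is finitely generated, one multiplier serves for all. *)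
Lemma cut_set_associated S : cut_set e S -> associated_prime J (graph_prime e S).
Proof.
move=> cutS; have prP := graph_prime_prime e k S; split=> //.
set P := graph_prime e S in prP *; case: (prP) => [[P0 PD PM] P1 Pprime].
have [J0 JD JM] : is_ideal J by apply: ideal_gen_ideal.
pose J' (b : R) := exists a, ~ P a /\ J (a * b).
have nPM a b : ~ P a -> ~ P b -> ~ P (a * b) by move=> na nb /Pprime[].
have idJ' : is_ideal J'.
  split.
  - by exists 1; rewrite mulr0.
  - move=> b c [u [nu Ju]] [v [nv Jv]]; exists (u * v); split; first exact: nPM.
    have -> : u * v * (b + c) = v * (u * b) + u * (v * c) by ring.
    by apply: JD; apply: JM.
  - move=> a b [u [nu Ju]]; exists u; split=> //.
    have -> : u * (a * b) = a * (u * b) by ring.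
    exact: JM.
have JJ' b : J b -> J' b by move=> Jb; exists 1; rewrite mul1r.
have J'f i j : i \notin S -> connect (deletion e S) i j -> J' (f i j).
  apply: edge_binomial_walk => // [u v /J_edge/JJ' //|v vS].
  left=> b [a [na Ja]]; exists (a * x v); rewrite -mulrA; split=> //.
  by apply: nPM => //; apply: graph_prime_xvar.
have J'var s : s \in S -> J' (x s) /\ J' (y s).
  move=> sS; have /forall_inP/(_ s sS)/existsP[a /existsP[b]] := cutS.
  case/and5P=> esa esb aS bS sep.
  have nab : ~ P (f a b) by move/graph_prime_binomial; rewrite (negPf sep) => /(_ aS bS).
  split; exists (f a b); split=> //.
    have -> : f a b * x s = x a * f s b + (- x b) * f s a.
      by rewrite /edge_binomial; ring.
    by apply: JD; apply: JM; apply: J_edge.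
  have -> : f a b * y s = y a * f s b + (- y b) * f s a.
    by rewrite /edge_binomial; ring.
  by apply: JD; apply: JM; apply: J_edge.
pose gs := [seq x s | s <- enum S] ++ [seq y s | s <- enum S] ++
  [seq f ij.1 ij.2 | ij <- enum {: 'I_n * 'I_n}
                   & (ij.1 \notin S) && connect (deletion e S) ij.1 ij.2].
have gsP g : g \in gs -> J' g.
  rewrite !mem_cat => /or3P[] /mapP[].
  - by move=> s; rewrite mem_enum => /J'var[? _] ->.
  - by move=> s; rewrite mem_enum => /J'var[_ ?] ->.
  - by move=> [i j] /=; rewrite mem_filter /= => /andP[/andP[iS c] _] ->; apply: J'f.
have [a [na Ja]] : exists a, ~ P a /\ forall g, g \in gs -> J (a * g).
  elim: (gs) gsP => [_|g r IHr rP]; first by exists 1.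
  have [a [na Ja]] := IHr (fun g' gr => rP g' (@mem_behead _ (g :: r) g' gr)).
  have [b [nb Jb]] := rP g (mem_head _ _).
  exists (a * b); split=> [|h]; first exact: nPM.
  rewrite inE => /orP[/eqP ->|/Ja Jah]; first by rewrite -mulrA; apply: JM.
  by rewrite mulrAC mulrC; apply: JM.
exists a => b; split; last first.
  by move/(@J_sub_graph_prime S)/Pprime => [].
move=> Pb; rewrite mulrC.
apply: (graph_prime_gens (L := fun b => J (a * b)) e_sym _ _ _ Pb).
- split; first by rewrite mulr0.
    by move=> u v Ju Jv; rewrite mulrDr; apply: JD.
  by move=> u v Jv; rewrite mulrCA; apply: JM.
- move=> s sS; split; apply: Ja; rewrite !mem_cat; apply/or3P.
    by apply: Or31; apply: map_f; rewrite mem_enum.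
  by apply: Or32; apply: map_f; rewrite mem_enum.
- move=> i j iS jS c; apply: Ja; rewrite !mem_cat; apply/or3P; apply: Or33.
  apply/mapP; exists (i, j) => //; rewrite mem_filter /= iS c.
  by rewrite mem_enum.
Qed.

(** A walk through [s] enters and leaves [s] at neighbours that are already
  connected without it. *)
Lemma noncut_sub S s : s \in S ->
  (forall a b, e s a -> e s b -> a \notin S -> b \notin S -> connect (deletion e S) a b) ->
  subideal (graph_prime e (S :\ s)) (graph_prime e S : R -> Prop).
Proof.
move=> sS nocut; apply: graph_prime_gens => //.
- by case: (graph_prime_prime e k S).
- by move=> t /setD1P[_ tS]; apply: graph_prime_var.
move=> i j iS' jS' cij; apply: graph_prime_binomial_in.
have [//|iS] := boolP (i \in S); have [//|/= jS] := boolP (j \in S).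
pose A v := if v == s then exists a, [/\ e s a, a \notin S & connect (deletion e S) i a]
            else connect (deletion e S) i v.
have nS v : v \notin S :\ s -> v != s -> v \notin S by rewrite !inE => + vs; rewrite vs.
have neS v : v \notin S -> v != s by apply: contraNneq => ->.
suff : A j by rewrite /A (negPf (neS _ jS)).
move: j cij {jS jS'}; apply: connect_ind; first by rewrite /A (negPf (neS _ iS)).
move=> v w civ; rewrite /A; have [->|vs] := eqVneq v s.
  move=> [a [esa aS cia]] /and3P[esw _ wS'].
  case: (eqVneq w s) => [_|ws]; first by exists a.
  by apply: connect_trans cia (nocut _ _ _ _ _ _) => //; apply: nS.
move=> civ' /and3P[evw vS' wS']; have vS := nS _ vS' vs.
case: (eqVneq w s) evw => [->|ws] evw; first by exists v; rewrite e_sym.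
apply: connect_trans civ' (connect1 _).
by rewrite /deletion evw vS nS.
Qed.

(** Dropping from [S] a vertex that violates the condition on cut sets only
  shrinks the prime. *)
Lemma cut_set_below S : exists2 S', cut_set e S' &
  subideal (graph_prime e S') (graph_prime e S : R -> Prop).
Proof.
have [d] := ubnP #|S|; elim: d S => [//|d IHd] S ltS.
have [cut|] := boolP (cut_set e S); first by exists S => // ?.
case/forall_inPn => s sS; rewrite negb_exists => /forallP nocut.
have [|S' cut' sub'] := IHd (S :\ s).
  by move: ltS; rewrite (cardsD1 s) sS ltnS.
exists S' => // p /sub'; apply: noncut_sub => // a b ea eb aS bS.
have := nocut a; rewrite negb_exists => /forallP/(_ b).
by rewrite ea eb aS bS negbK.
Qed.

(** Start from the vertices both of whose variables lie in [P]: outside them one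
  of [x_v], [y_v] can be cancelled modulo [P]. *)
Lemma prime_above_J (P : R -> Prop) : is_prime_ideal P -> subideal J P ->
  exists2 S, cut_set e S & subideal (graph_prime e S) P.
Proof.
move=> prP sJP; have [idP _ Pprime] := prP.
have [S HS] : exists S : {set 'I_n}, forall v, v \in S <-> P (x v) /\ P (y v).
  have /fin_all_exists[S HS] v : exists b : bool, b <-> P (x v) /\ P (y v).
    by have [Pv|nPv] := classic (P (x v) /\ P (y v)); [exists true | exists false].
  by exists [set v | S v] => v; rewrite inE.
have [S' cut' sub'] := cut_set_below S; exists S' => // p /sub'.
apply: graph_prime_gens => // [s /HS //|i j iS jS].
apply: edge_binomial_walk => // [u v /J_edge/sJP //|v vS].
have /not_and_or[nx|ny] : ~ (P (x v) /\ P (y v)) by move/HS; apply/negP.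
  by left=> b /Pprime[].
by right=> b /Pprime[].
Qed.

Lemma unmixed_killed S : unmixed J -> cut_set e S -> #|killed e S| = #|killed e set0|.
Proof.
move=> unm cutS; apply: prime_height_uniq (graph_prime_height k e_sym S) _.
apply/(unm _ _ (cut_set_associated cutS) (cut_set_associated (cut_set0 e))).
exact: graph_prime_height.
Qed.

Lemma unmixed_height h : unmixed J -> ideal_height J h -> h = #|killed e set0|.
Proof.
move=> unm [[P [prP sJP [geP ngeP]]] least]; apply/eqP; rewrite eqn_leq; apply/andP; split.
  apply: (@graph_prime_height_le _ e k); apply: least; last exact: J_sub_graph_prime.
  exact: graph_prime_prime.
have [S cutS sub] := prime_above_J prP sJP.
rewrite leqNgt; apply/negP => lth; apply: ngeP; apply: prime_height_ge_le lth _.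
rewrite -(unmixed_killed unm cutS); apply: prime_height_ge_sub sub _ => //.
exact: graph_prime_height_ge.
Qed.

End CutSets.

(** * Generators of Koenig type *)

Section MonomialOrder.

Variables (k : fieldType) (N : nat) (le : rel 'X_{1..N}).
Hypothesis leM : monomial_order le.
Implicit Types (p : {mpoly k[N]}) (m u v w : 'X_{1..N}).

Lemma initial_exponentP p : p != 0 ->
  initial_exponent le p \in msupp p /\
  forall u, u \in msupp p -> le u (initial_exponent le p).
Proof.
have [anti tr tot le0 _] := leM.
have lexx u : le u u by have := tot u u; rewrite orbb.
rewrite -msupp_eq0 /initial_exponent; move: (msupp p) => s s0.
set r := foldr _ _ s.
have [rP maxr] : (r \in 0%MM :: s) /\ forall u, u \in s -> le u r.
  rewrite /r; elim: (s) => [|u s' [IHm IHle]] /=; first by rewrite mem_head.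
  set r' := foldr _ _ s' in IHm IHle *; case: ifP => leur'; split.
  - by move: IHm; rewrite !inE => /orP[->|->]; rewrite ?orbT.
  - by move=> v; rewrite inE => /orP[/eqP ->|/IHle].
  - by rewrite !inE eqxx orbT.
  - move=> v; rewrite inE => /orP[/eqP ->|/IHle lev]; first exact: lexx.
    by apply: tr lev _; have := tot u r'; rewrite leur'.
split=> //; move: rP; rewrite inE => /orP[/eqP Er|//].
case: s s0 => [//|u s'] _ in r maxr Er *.
have := maxr u (mem_head _ _); rewrite Er => leu0.
by rewrite (anti 0%MM u) ?mem_head // leu0 le0.
Qed.

(** Addition is strictly monotone, so equality of sums forces equality of
  terms. *)
Lemma sum_le_eq (I : finType) (W : {set I}) (u w : I -> 'X_{1..N}) :
  (forall i, i \in W -> le (u i) (w i)) ->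
  (\sum_(i in W) u i)%MM = (\sum_(i in W) w i)%MM ->
  forall i, i \in W -> u i = w i.
Proof.
have [anti tr tot _ leD] := leM => leuw Esum i Wi.
have lexx v : le v v by have := tot v v; rewrite orbb.
pose W' := [pred j | (j \in W) && (j != i)].
have leW : le (\sum_(j | W' j) u j)%MM (\sum_(j | W' j) w j)%MM.
  elim/big_rec2: _ => [|j a b /andP[Wj _] leab]; first exact: lexx.
  apply: (tr (w j + b)%MM); first exact/leD/leuw.
  by rewrite addmC [X in le _ X]addmC; apply: leD.
have [Eu Ew] : (\sum_(j in W) u j = u i + \sum_(j | W' j) u j)%MM /\
    (\sum_(j in W) w j = w i + \sum_(j | W' j) w j)%MM.
  by split; rewrite (bigD1 i).
apply: (@addIm _ (\sum_(j | W' j) u j)%MM); apply: anti.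
rewrite leD ?leuw //= -Eu Esum Ew.
by rewrite addmC [X in le _ X]addmC; apply: leD.
Qed.

End MonomialOrder.

Section Konig.

Variables (n : nat) (e : rel 'I_n) (k : fieldType).
Hypotheses (e_sym : ssrbool.symmetric e) (e_irr : irreflexive e).
Local Notation N := (n + n)%N.
Local Notation R := {mpoly k[N]}.
Local Notation f := (edge_binomial k).
Local Notation J := (binomial_edge_ideal k e).
Implicit Types (m u v w : 'X_{1..N}) (p q : R).

Definition xy (a b : 'I_n) : 'X_{1..N} := (U_(lshift n a) + U_(rshift n b))%MM.

Lemma xyL a b i : xy a b (lshift n i) = (a == i).
Proof. by rewrite mnmDE !mnm1E eq_lshift eq_rlshift addn0. Qed.

Lemma xyR a b i : xy a b (rshift n i) = (b == i).
Proof. by rewrite mnmDE !mnm1E eq_lrshift eq_rshift. Qed.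

Lemma eq_xy a b i j : (xy a b == xy i j) = (a == i) && (b == j).
Proof.
apply/eqP/andP => [/mnmP E|[/eqP -> /eqP ->] //].
have := E (lshift n i); have := E (rshift n j); rewrite !xyL !xyR !eqxx.
by case: (a == i); case: (b == j).
Qed.

Lemma mdeg_xy a b : mdeg (xy a b) = 2%N.
Proof. by rewrite mdegD !mdeg1. Qed.

Lemma edge_binomialE i j : f i j = 'X_[xy i j] - 'X_[xy j i].
Proof. by rewrite /edge_binomial /xvar /yvar -!mpolyXD. Qed.

Lemma mcoeffMX_low p u m : (mdeg m <= mdeg u)%N ->
  (p * 'X_[u])@_m = p@_0 * (m == u)%:R.
Proof.
move=> lemu; case: eqP => [->|neq].
  by rewrite -[X in mcoeff X _]addm0 mcoeffMX mulr1.
rewrite mulr0; apply: memN_msupp_eq0; rewrite (perm_mem (msuppMX p u)).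
apply/mapP => -[w _ Em]; apply: neq; rewrite Em; suff -> : w = 0%MM by rewrite addm0.
by apply/eqP; rewrite -mdeg_eq0; move: lemu; rewrite Em mdegD; lia.
Qed.

(** In low degree only the constant terms of the coefficients of the [f i j]
  contribute, so the quadratic part of [p] is a linear
  combination of the [f i j]. *)
Lemma J_low_coeff p : J p ->
  (forall m, (mdeg m <= 2)%N -> p@_m != 0 -> exists a b, e a b /\ m = xy a b) /\
  (forall a b, p@_(xy a b) = - p@_(xy b a)).
Proof.
case=> cs As ->; rewrite big_seq.
pose Q q := (forall m, (mdeg m <= 2)%N -> q@_m != 0 -> exists a b, e a b /\ m = xy a b) /\
  (forall a b, q@_(xy a b) = - q@_(xy b a)).
rewrite -/(Q _); elim/big_ind: _ => [|q q' [lq aq] [lq' aq']|[c g] /As /= [i [j [eij ->]]]].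
- by split=> [m _|a b]; rewrite !mcoeff0 ?eqxx ?oppr0.
- split=> [m lem|a b]; rewrite !mcoeffD; last by rewrite aq aq' opprD.
  by have [->|/(lq m lem) //] := eqVneq q@_m 0; rewrite add0r; apply: lq'.
have E m : (mdeg m <= 2)%N ->
    (c * f i j)@_m = c@_0 * ((m == xy i j)%:R - (m == xy j i)%:R).
  by move=> lem; rewrite edge_binomialE mulrBr mcoeffB !mcoeffMX_low ?mdeg_xy // mulrBr.
split=> [m lem|a b]; last first.
  rewrite !E ?mdeg_xy // !eq_xy [(b == i) && _]andbC [(b == j) && _]andbC.
  by rewrite -mulrN opprB.
rewrite E //; have [-> _|_] := eqVneq m (xy i j).
  by exists i, j.
have [-> _|_] := eqVneq m (xy j i); last by rewrite subrr mulr0 eqxx.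
by exists j, i; rewrite e_sym.
Qed.

Lemma J_mdeg_ge2 p m : J p -> m \in msupp p -> (1 < mdeg m)%N.
Proof.
move=> /J_low_coeff[low _]; rewrite mcoeff_msupp ltnNge => pm.
apply/negP => lem; have [|a [b [_ Em]]] := low m _ pm; first exact: leqW.
by move: lem; rewrite Em mdeg_xy.
Qed.

(** The degree-two members of a homogeneous generating system already generate
  the quadrics [f i j], hence a minimal one has no others. *)
Lemma minimal_generators_quadrics (t : seq R) :
  minimal_generators J t -> forall g, g \in t -> (g != 0) && (g \is 2%N.-homog).
Proof.
move=> [homt genJ mint]; pose Q (g : R) := (g != 0) && (g \is 2%N.-homog).
suff : filter Q t = t by move=> Et g; rewrite -Et mem_filter => /andP[].
apply: mint; first exact: filter_subseq.
have tJ g : g \in t -> J g by move=> tg; apply/genJ/ideal_gen_mem.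
have idF := ideal_gen_ideal (fun g => g \in filter Q t); have [F0 FD FM] := idF.
move=> p; split.
  apply: ideal_gen_sub; first exact: ideal_gen_ideal.
  by move=> g; rewrite mem_filter => /andP[_ /tJ].
apply: ideal_gen_sub => // _ [i [j [eij ->]]].
have fh : f i j \is 2%N.-homog.
  by rewrite edge_binomialE rpredB // dhomogX /= mdeg_xy.
have : J (f i j) by apply: ideal_gen_mem; exists i, j.
move/genJ => [cs tcs Ef]; rewrite -(pihomog_dE fh) Ef raddf_sum /=.
apply: ideal_sum => // -[c g] /tcs /= tg.
rewrite [c]mpolyE mulr_suml raddf_sum; apply: ideal_sum => // w _.
rewrite -scalerAl /= linearZ /= -mul_mpolyC; apply: (FM).
have [->|nz_g] := eqVneq g 0; first by rewrite mulr0 raddf0.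
have [d gd] := homt g tg.
have wgd : 'X_[w] * g \is (mdeg w + d).-homog by apply: dhomogM => //; rewrite dhomogX.
have d2 : (1 < d)%N.
  rewrite -(dhomogP _ _ _ gd _ (mlead_supp nz_g)).
  exact: J_mdeg_ge2 (tJ g tg) (mlead_supp nz_g).
have [Ed|ned] := eqVneq (mdeg w + d)%N 2%N; last by rewrite (pihomog_ne0 ned).
rewrite -Ed (pihomog_dE wgd); apply/FM/ideal_gen_mem; rewrite mem_filter tg andbT /Q nz_g.
by have <- : d = 2%N by lia.
Qed.

Lemma sum_mX_low (s : seq R) p m :
  (forall g, g \in s -> exists c u, g = c *: 'X_[u] /\ mdeg u = 2%N) ->
  ideal_of_seq s p -> (mdeg m < 2)%N -> p@_m = 0.
Proof.
move=> sP [cs scs ->] ltm; rewrite raddf_sum /= big1_seq // => c /andP[_ /scs/sP].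
case=> a [u [-> du]]; rewrite -scalerAr mcoeffZ mcoeffMX_low ?du; last exact: ltnW.
by case: eqP => [Em|_]; rewrite ?mulr0 //; move: ltm; rewrite Em du.
Qed.

(** If [z] divides both [u i] and [u j] with [j < i], then [u j / z] multiplies
  the [i]-th member into the ideal of the [j]-th, yet its degree is too small
  for an ideal generated by quadrics. *)
Lemma regular_monomials_coprime (s : seq R) (c : nat -> k) (u : nat -> 'X_{1..N}) :
  (forall i, (i < size s)%N -> [/\ s`_i = c i *: 'X_[u i], c i != 0 & mdeg (u i) = 2%N]) ->
  regular_sequence s ->
  forall i j z, (j < i < size s)%N -> u i z != 0%N -> u j z = 0%N.
Proof.
move=> sP [reg _] i j z /andP[ltji lti] uiz; apply/eqP/negPn/negP => ujz.
have [Ei ci di] := sP i lti; have [Ej cj dj] := sP j (ltn_trans ltji lti).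
have Ui : (u i = u i - U_(z) + U_(z))%MM by rewrite submK // lep1mP.
have Uj : (u j = u j - U_(z) + U_(z))%MM by rewrite submK // lep1mP.
have := reg i lti 'X_[u j - U_(z)].
have Esj : s`_j \in take i s.
  by rewrite -(nth_take 0 ltji); apply: mem_nth; rewrite size_take lti.
case=> [|cs Hcs Ecs].
  have -> : 'X_[u j - U_(z)] * s`_i = (c i / c j) *: 'X_[u i - U_(z)] * s`_j.
    rewrite Ei Ej -scalerAl -!scalerAr scalerA divfK // [in RHS]Uj [in LHS]Ui !mpolyXD.
    by congr (_ *: _); ring.
  have [_ _ IM] := ideal_gen_ideal (fun g => g \in take i s).
  exact/IM/ideal_gen_mem.
have dw : (mdeg (u j - U_(z))%MM < 2)%N.
  by move: dj; rewrite {1}Uj mdegD mdeg1; lia.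
have w0 : ('X_[u j - U_(z)] : R)@_(u j - U_(z)) = 0.
  apply: (@sum_mX_low (take i s)) => //; last by exists cs.
  move=> g /(nthP 0)[l]; rewrite size_take lti => ltl <-.
  have [El _ dl] := sP l (ltn_trans ltl lti).
  by exists (c l), (u l); rewrite nth_take.
by move/eqP: w0; rewrite mcoeffX eqxx oner_eq0.
Qed.

(** The initial monomials give a partial successor relation: coprimality makes
  it injective both ways, and a set stable under predecessors is impossible
  because the product of the [x_(q b) y_b] over it equals that of the smaller
  monomials [x_b y_(q b)]. *)
Lemma konig_matching : konig_type J -> exists2 M : seq ('I_n * 'I_n),
  ideal_height J (size M) &
  [/\ forall a b, (a, b) \in M -> e a b,
      uniq (unzip1 M), uniq (unzip2 M)
    & forall W : {set 'I_n}, W != set0 ->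
        exists2 b, b \in W & forall a, a \in W -> (a, b) \notin M].
Proof.
move=> [gs [le [hgs [s mins] leM reg]]].
pose ini (g : R) := initial_exponent le g.
have gsP g : g \in gs -> [/\ J g, g != 0 & g \is 2%N.-homog].
  move=> gg; have tg : g \in gs ++ s by rewrite mem_cat gg.
  have /andP[nz hg] := minimal_generators_quadrics mins tg; split=> //.
  by have [_ genJ _] := mins; apply/genJ/ideal_gen_mem.
have iniP g : g \in gs -> [/\ ini g \in msupp g, mdeg (ini g) = 2%N &
    forall u, u \in msupp g -> le u (ini g)].
  move=> /gsP[Jg nz hg]; have [ig maxg] := initial_exponentP leM nz.
  by split=> //; apply: dhomogP ig.
have iniE g : g \in gs -> exists ab : 'I_n * 'I_n,
    [/\ ini g = xy ab.1 ab.2, e ab.1 ab.2 & le (xy ab.2 ab.1) (xy ab.1 ab.2)].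
  move=> gg; have [Jg _ _] := gsP g gg; have [ig dg maxg] := iniP g gg.
  have [low anti] := J_low_coeff Jg.
  have [||a [b [eab Eg]]] := low (ini g); [by rewrite dg | by rewrite -mcoeff_msupp|].
  exists (a, b); split=> //.
  rewrite /= -Eg; apply: maxg; rewrite mcoeff_msupp anti oppr_eq0 -Eg.
  by rewrite -mcoeff_msupp.
have [M [sM MP]] : exists M : seq ('I_n * 'I_n), size M = size gs /\
    forall i d0, (i < size gs)%N -> let ab := nth d0 M i in
      [/\ ini gs`_i = xy ab.1 ab.2, e ab.1 ab.2
        & le (xy ab.2 ab.1) (xy ab.1 ab.2)].
  elim: (gs) iniE => [|g gs' IH] iniE'; first by exists [::].
  have [ab abP] := iniE' g (mem_head _ _).
  have [|M [sM MP]] := IH; first by move=> g' gg'; apply: iniE'; rewrite inE gg' orbT.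
  exists (ab :: M); split=> [|[|i] d0 lti]; [by rewrite /= sM | exact: abP | exact: MP].
exists M; first by rewrite sM.
have cop : forall i j z, (j < i < size gs)%N -> ini gs`_i z != 0%N -> ini gs`_j z = 0%N.
  move=> i j z; have := @regular_monomials_coprime [seq initial_term le g | g <- gs]
    (fun i => gs`_i@_(ini gs`_i)) (fun i => ini gs`_i); rewrite size_map.
  apply=> // l ltl; rewrite (nth_map 0) //; have /iniP[ig dg _] := mem_nth 0 ltl.
  by split=> //; rewrite -mcoeff_msupp.
have cop' i j z : (i < size gs)%N -> (j < size gs)%N -> i != j ->
    ini gs`_i z != 0%N -> ini gs`_j z = 0%N.
  move=> lti ltj; rewrite neq_ltn => /orP[ltij|ltji] nz; last by apply: (cop i); rewrite ?ltji.
  by apply/eqP/negPn/negP => /(cop j i) E; move: nz; rewrite E ?ltij ?eqxx.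
have memM ab : ab \in M -> e ab.1 ab.2.
  by move=> /(nthP ab)[i]; rewrite sM => lti <-; have [] := MP i ab lti.
have uq (F : 'I_n * 'I_n -> 'I_n) :
    (forall i j d0, (i < size gs)%N -> (j < size gs)%N -> i != j ->
       F (nth d0 M i) != F (nth d0 M j)) -> uniq (map F M).
  move=> HF; have [->//|M0] := eqVneq M [::].
  have [d0 _] : exists d0, d0 \in M.
    by case: (M) M0 => // d0 M' _; exists d0; rewrite mem_head.
  apply/(uniqP (F d0)) => i j; rewrite !inE size_map sM => lti ltj.
  rewrite !(nth_map d0) ?sM // => EF; apply/eqP/negPn/negP => nij.
  by have := HF i j d0 lti ltj nij; rewrite EF eqxx.
have uM1 : uniq (unzip1 M).
  apply: uq => i j d0 lti ltj nij; apply/eqP => EF.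
  have [Ei _ _] := MP i d0 lti; have [Ej _ _] := MP j d0 ltj.
  have := cop' i j (lshift n (nth d0 M i).1) lti ltj nij.
  by rewrite Ei Ej !xyL eqxx EF eqxx => /(_ isT).
have uM2 : uniq (unzip2 M).
  apply: uq => i j d0 lti ltj nij; apply/eqP => EF.
  have [Ei _ _] := MP i d0 lti; have [Ej _ _] := MP j d0 ltj.
  have := cop' i j (rshift n (nth d0 M i).2) lti ltj nij.
  by rewrite Ei Ej !xyR eqxx EF eqxx => /(_ isT).
split=> // [a b /memM //|W W0].
apply: NNPP => noW.
have /fin_all_exists[q qP] b : exists a, b \in W -> a \in W /\ (a, b) \in M.
  have [Wb|] := boolP (b \in W); last by exists b.
  apply: NNPP => nob; apply: noW; exists b => // a Wa; apply/negP => Mab.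
  by apply: nob; exists a.
have injq : {in W &, injective q}.
  move=> b b' /qP[_ Mb] /qP[_ Mb'] Eq.
  move: Mb Mb' => /(nthP (b, b))[i]; rewrite sM => lti Ei /(nthP (b, b))[j].
  rewrite sM => ltj Ej; have : i = j.
    apply/eqP; rewrite -(nth_uniq b _ _ uM1) ?size_map ?sM //.
    by rewrite !(nth_map (b, b)) ?sM // Ei Ej /= Eq.
  by move=> Eij; move: Ei; rewrite Eij Ej => -[].
have qW : q @: W = W.
  apply/eqP; rewrite eqEcard card_in_imset // leqnn andbT.
  by apply/subsetP => _ /imsetP[b /qP[Wq _] ->].
have leW b : b \in W -> le (xy b (q b)) (xy (q b) b).
  move=> /qP[_ /(nthP (b, b))[i]]; rewrite sM => lti Ei.
  by have [_ _] := MP i (b, b) lti; rewrite Ei.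
have sumq (F : 'I_n -> 'X_{1..N}) : (\sum_(b in W) F (q b) = \sum_(b in W) F b)%MM.
  by rewrite -[in RHS]qW big_imset.
have Esum : (\sum_(b in W) xy b (q b) = \sum_(b in W) xy (q b) b)%MM.
  rewrite /xy !big_split /= (sumq (fun b => U_(rshift n b)%MM)).
  by rewrite (sumq (fun b => U_(lshift n b)%MM)).
have [b Wb] := set0Pn _ W0; have [_ Mb] := qP b Wb.
have /eqP := sum_le_eq leM leW Esum Wb.
rewrite eq_xy => /andP[/eqP Eb _].
by have := memM _ Mb; rewrite /= -Eb e_irr.
Qed.

End Konig.

Theorem corollary10p4 (n : nat) (e : rel 'I_n)
    (e_sym : ssrbool.symmetric e) (e_irr : irreflexive e) (k : fieldType) :
  unmixed (binomial_edge_ideal k e) ->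
  konig_type (binomial_edge_ideal k e) ->
  weakly_closed e.
Proof.
move=> unm /(konig_matching e_sym e_irr)[M hM [Me uM1 uM2 acyc]].
have sM := unmixed_height e_sym unm hM.
have [l lP] := rank_perm (path_key_inj (acyclic := acyc) uM1).
exists l => i j v eij /lP ltiv /lP ltvj.
have [evi|nvi] := boolP (e v i); first by left; rewrite e_sym.
have [evj|nvj] := boolP (e v j); first by right.
have niv : i != v by apply: contraTneq ltiv => ->; rewrite ltnn.
have [S [cutS vS NS /negP[]]] := neighbourhood_cut_set e_sym e_irr niv nvi.
have iS := NS i nvi; have jS := NS j nvj.
have cij : connect (deletion e S) i j by apply/connect1; rewrite /deletion eij iS.
apply: connect_trans (cij) _; apply: (between_connect uM1 uM2 e_sym Me) ltiv ltvj => //.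
  rewrite sM -(unmixed_killed e_sym unm cutS) killed_card card_ord.
  exact: leqnn.
by apply/eqP; rewrite eq_component.
Qed.
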